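(* Fix $\alpha\in(0,1)$. Let $(\mathcal X^{(n)},X^{(n)})_{n\ge1}$ be a family of Markov chains with target sets $G^{(n)}$ such that, for each $n$, condition $Hp.G(R_n,d_n,f_n,r_n)$ holds, where $d_n,f_n,r_n\to0$ as $n\to\infty$. Then, as $n\to\infty$, the following convergence in law holds: $$\frac{\tau^{\pi_A}_{G^{(n)}}}{\mathbf E[\tau^{\pi_A}_{G^{(n)}}]}\ \longrightarrow\ \mathcal E(1),$$ where $\mathcal E(1)$ is an exponentially distributed random variable with mean one and $\pi_A=\pi^{(n)}_{A^{(n)}}$. Furthermore, for any sequence of starting probability measures $\mu^{(n)}$ with support contained in $B^{(n)}_\alpha$, the following convergence in law holds: $$\frac{\tau^{\mu^{(n)}}_{G^{(n)}}}{\mathbf E[\tau^{\mu^{(n)}}_{G^{(n)}}]}\ \longrightarrow\ \mathcal E(1).$$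
   Context: For each $n$ the following setting is considered (the index $n$ is dropped). $\mathcal X$ is a finite set and $X=(X_t)_{t\ge0}$ is an irreducible continuous-time Markov chain on $\mathcal X$ with transition rates $Q$ and invariant probability measure $\pi$; reversibility is not assumed. $X^{\leftarrow}$ denotes the time-reversed chain, with rates $Q^*(x,y)=\frac{\pi(y)}{\pi(x)}Q(y,x)$. A superscript $x$ (or a probability measure $\nu$) denotes the starting point (or initial law); $\tau^x_K=\inf\{t\ge0: X^x_t\in K\}$, and $\tau^{\leftarrow x}_K$ is the same for $X^{\leftarrow}$. $G\subset\mathcal X$ is a target set, $A:=\mathcal X\setminus G$, and $\pi_A(\cdot)=\pi(\cdot)\mathbf 1_{\{\cdot\in A\}}/\pi(A)$. $d_{TV}(\pi_1,\pi_2)=\frac12\sum_{x}|\pi_1(x)-\pi_2(x)|$, $\mu^x_t(\cdot)=\mathbf P(X^x_t=\cdot)$, and for $K\subset\mathcal X$, $\bar d_K(t)=\max_{x,x'\in K}d_{TV}(\mu^x_t,\mu^{x'}_t)$. Hypotheses. Let $f_A(t):=\mathbf P(\tau_G^{\pi_A}\le t)=\frac12\sum_{x\in A}\pi_A(x)\left[\mathbf P(\tau_G^x\le t)+\mathbf P(\tau_G^{\leftarrow x}\le t)\right]$. For $R>1$, $d,f,r\in(0,1)$ and $\alpha\in(0,1)$: - $E(R,f)$ (slow escape): $f_A(2R)\le f$. - $B_\alpha:=\left\{x\in A:\ \frac12\left[\mathbf P(\tau_G^x\le2R)+\mathbf P(\tau_G^{\leftarrow x}\le2R)\right]\le f^\alpha\right\}$.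 - $T(R,d)$ (fast thermalization): $\bar d_{B_\alpha}(R)\le d$. - $Rc(R,r)$ (fast recurrence): $\sup_{x\in\mathcal X}\mathbf P(\tau^x_{B_\alpha\cup G}>R)<r$. - $Hp.G(R,d,f,r)$: $E(R,f)$, $T(R,d)$ and $Rc(R,r)$ hold simultaneously. *)

(* Defs.v *)
From HB Require Import structures.
From mathcomp Require Import all_boot all_order all_algebra.
From mathcomp Require Import all_classical all_reals all_analysis.

Set Implicit Arguments.
Unset Strict Implicit.
Unset Printing Implicit Defensive.

Import Order.TTheory GRing.Theory Num.Theory.
Import numFieldNormedType.Exports.

Local Open Scope classical_set_scope.
Local Open Scope ring_scope.

(* A rate function is Q : S -> S -> R, of which only the off-diagonal values
   Q x y (x != y) carry information: the values Q x x are irrelevant in every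
   definition below, so that both the convention Q x x = 0 and the convention
   Q x x = - \sum_(y | y != x) Q x y are covered. *)
Definition is_rate (R : realType) (S : finType) (Q : S -> S -> R) : Prop :=
  forall x y, x != y -> 0 <= Q x y.

Definition irreducible_rate (R : realType) (S : finType)
    (Q : S -> S -> R) : Prop :=
  forall x y, connect [rel u v | (u != v) && (0 < Q u v)] x y.

Definition is_law (R : realType) (S : finType) (nu : S -> R) : Prop :=
  (forall x, 0 <= nu x) /\ \sum_x nu x = 1.

Definition point_law (R : realType) (S : finType) (x : S) : S -> R :=
  fun y => (y == x)%:R.

Definition invariant_law (R : realType) (S : finType) (Q : S -> S -> R)
    (pi : S -> R) : Prop :=
  is_law pi /\
  forall y, \sum_(x | x != y) pi x * Q x y = pi y * \sum_(z | z != y) Q y z.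

Definition reversed_rate (R : realType) (S : finType) (Q : S -> S -> R)
    (pi : S -> R) : S -> S -> R :=
  fun x y => pi y / pi x * Q y x.

Definition generator (R : realType) (S : finType) (Q : S -> S -> R)
    (g : S -> R) : S -> R :=
  fun x => \sum_(y | y != x) Q x y * (g y - g x).

(* The (x, y) entry of exp (t L), L being the generator of Q. *)
Definition transition (R : realType) (S : finType) (Q : S -> S -> R)
    (t : R) (x y : S) : R :=
  limn (series (fun k : nat =>
    t ^+ k / k`!%:R * iter k (generator Q) (fun z => (z == y)%:R) x)).

(* X t w is only meaningful for t >= 0. *)
Record is_ctmc (R : realType) (S : finType) (d : measure_display)
    (Omega : measurableType d) (P : probability Omega R)
    (Q : S -> S -> R) (nu : S -> R) (X : R -> Omega -> S) : Prop := IsCTMC {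
  ctmc_measurable : forall t x, 0 <= t -> measurable [set w | X t w = x];
  ctmc_right_continuous : forall w t, 0 <= t ->
    exists2 e : R, 0 < e & forall s, t <= s < t + e -> X s w = X t w;
  ctmc_fdd : forall (k : nat) (t : nat -> R) (x : nat -> S),
    t 0%N = 0 -> (forall i, (i < k)%N -> t i <= t i.+1) ->
    P [set w | forall i, (i <= k)%N -> X (t i) w = x i] =
    (nu (x 0%N) *
     \prod_(i < k) transition Q (t i.+1 - t i) (x i) (x i.+1))%:E }.

(* +oo if K is never visited *)
Definition hitting_time (R : realType) (S : finType) (T : Type)
    (X : R -> T -> S) (K : {set S}) (w : T) : \bar R :=
  ereal_inf [set t%:E | t in [set t : R | 0 <= t /\ X t w \in K]].

Definition hit_by (R : realType) (S : finType) (d : measure_display)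
    (Omega : measurableType d) (P : probability Omega R)
    (X : R -> Omega -> S) (K : {set S}) (t : R) : R :=
  fine (P [set w | (hitting_time X K w <= t%:E)%E]).

Definition hit_after (R : realType) (S : finType) (d : measure_display)
    (Omega : measurableType d) (P : probability Omega R)
    (X : R -> Omega -> S) (K : {set S}) (t : R) : R :=
  fine (P [set w | (t%:E < hitting_time X K w)%E]).

Definition dTV (R : realType) (S : finType) (p q : S -> R) : R :=
  2^-1 * \sum_x `|p x - q x|.

(* From now on a chain is given as a family X of processes on one probability
   space, X nu being the chain with initial law nu; X (point_law x) is X^x. *)

Definition marginal (R : realType) (S : finType) (d : measure_display)
    (Omega : measurableType d) (P : probability Omega R)
    (X : (S -> R) -> R -> Omega -> S) (x : S) (t : R) : S -> R :=
  fun y => fine (P [set w | X (point_law R x) t w = y]).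

Definition dbar (R : realType) (S : finType) (d : measure_display)
    (Omega : measurableType d) (P : probability Omega R)
    (X : (S -> R) -> R -> Omega -> S) (K : {set S}) (t : R) : R :=
  \big[Num.max/0]_(x in K) \big[Num.max/0]_(x' in K)
    dTV (marginal P X x t) (marginal P X x' t).

Definition cond_law (R : realType) (S : finType) (pi : S -> R)
    (A : {set S}) : S -> R :=
  fun x => if x \in A then pi x / \sum_(y in A) pi y else 0.

Definition fA (R : realType) (S : finType) (d : measure_display)
    (Omega : measurableType d) (P : probability Omega R) (pi : S -> R)
    (X : (S -> R) -> R -> Omega -> S) (G : {set S}) (t : R) : R :=
  hit_by P (X (cond_law pi (~: G)%SET)) G t.

(* Xrev is the time-reversed chain; the time scale is rho, as R is the field. *)
Definition Bset (R : realType) (S : finType) (d : measure_display)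
    (Omega : measurableType d) (P : probability Omega R)
    (X Xrev : (S -> R) -> R -> Omega -> S) (G : {set S})
    (alpha rho f : R) : {set S} :=
  [set x in (~: G)%SET |
    2^-1 * (hit_by P (X (point_law R x)) G (2 * rho) +
            hit_by P (Xrev (point_law R x)) G (2 * rho)) <= f `^ alpha]%SET.

Definition slow_escape (R : realType) (S : finType) (d : measure_display)
    (Omega : measurableType d) (P : probability Omega R) (pi : S -> R)
    (X : (S -> R) -> R -> Omega -> S) (G : {set S}) (rho f : R) : Prop :=
  fA P pi X G (2 * rho) <= f.

Definition fast_thermalization (R : realType) (S : finType)
    (d : measure_display) (Omega : measurableType d) (P : probability Omega R)
    (X : (S -> R) -> R -> Omega -> S) (B : {set S}) (rho delta : R) : Prop :=
  dbar P X B rho <= delta.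

Definition fast_recurrence (R : realType) (S : finType)
    (d : measure_display) (Omega : measurableType d) (P : probability Omega R)
    (X : (S -> R) -> R -> Omega -> S) (B G : {set S}) (rho r : R) : Prop :=
  \big[Num.max/0]_(x : S) hit_after P (X (point_law R x)) (B :|: G)%SET rho < r.

Record HpG (R : realType) (S : finType) (d : measure_display)
    (Omega : measurableType d) (P : probability Omega R) (pi : S -> R)
    (X Xrev : (S -> R) -> R -> Omega -> S) (G : {set S})
    (alpha rho delta f r : R) : Prop := IsHpG {
  HpG_E : slow_escape P pi X G rho f;
  HpG_T : fast_thermalization P X (Bset P X Xrev G alpha rho f) rho delta;
  HpG_Rc : fast_recurrence P X (Bset P X Xrev G alpha rho f) G rho r }.

(* Convergence of the distribution functions at every continuity point of the
   limit. The variables may take infinite values, the limit law mu lives on R. *)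
Definition cvg_in_law (R : realType) (d : nat -> measure_display)
    (Omega : forall n, measurableType (d n))
    (P : forall n, probability (Omega n) R)
    (Y : forall n, Omega n -> \bar R) (mu : set R -> \bar R) : Prop :=
  forall t : R, {for t, continuous (fun s : R => mu `]-oo, s]%classic)} ->
    P n [set w | (Y n w <= t%:E)%E] @[n --> \oo] --> mu `]-oo, t]%classic.

Definition normalized_hitting_time (R : realType) (S : finType)
    (d : measure_display) (Omega : measurableType d) (P : probability Omega R)
    (X : R -> Omega -> S) (G : {set S}) : Omega -> \bar R :=
  fun w => (hitting_time X G w / \int[P]_w' hitting_time X G w')%E.

(* Main.v *)
Require Import Defs.
From mathcomp Require Import all_boot all_order all_algebra.
From mathcomp Require Import all_classical all_reals all_analysis.
From mathcomp Require Import measurable_realfun.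
From mathcomp Require Import ring lra.

Set Implicit Arguments.
Unset Strict Implicit.
Unset Printing Implicit Defensive.

Import Order.TTheory GRing.Theory Num.Theory.
Import numFieldNormedType.Exports.

Local Open Scope classical_set_scope.
Local Open Scope ring_scope.

(* Write g(k) for the probability of not having hit G by time k R, from the
   given initial law. A chain which has not yet hit G reaches B or G within time
   R with high probability, and from two points of B its laws at time R are
   close, while G is unlikely to be hit within time 2 R; so the chain forgets its
   past, and |g(j + k) - g(j) g(k)| <= kappa g(j) with kappa -> 0. Summing this
   over j, the normalized tails v(k) = (sum_(i >= k) g(i)) / L, where
   L = sum_i g(i), satisfy v(k) - v(k + 1) = g(k) / L and |v(k) - g(k)| <= kappa,
   an approximate linear recursion; hence g(k) is within 2 kappa of
   (1 - 1/L)^k. Since E tau lies between R (L - 1) and R L, the exponential law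
   follows for every initial law under which G is unlikely to be hit before R.

   The strong Markov property is avoided by sampling the chain at the multiples
   of R / 2^m: for the sampled chain the estimates are inductions on the number
   of steps, and by right continuity its hitting probabilities converge to those
   of the chain as m -> oo. *)

(** * First-visit estimates for a killed discrete-time chain *)

Section KilledChain.
Variables (R : realType) (S : finType) (p : S -> S -> R).
Hypothesis p_ge0 : forall x y, 0 <= p x y.
Hypothesis p_sum1 : forall x, \sum_y p x y = 1.
Implicit Types (K : {set S}) (f g : S -> R) (x y : S).

(** Iterates give expectations over paths that stay outside [K]; with [K] empty this is the free
    evolution, so one operator serves for both. *)
Definition kill K f x : R := if x \in K then 0 else \sum_y p x y * f y.

(* Times [0, ..., n], both ends included. *)
Definition avoid K n : S -> R := iter n (kill K) (fun x => (x \notin K)%:R).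

Lemma avoidS K n x : avoid K n.+1 x = kill K (avoid K n) x.
Proof. by []. Qed.

Lemma avoid_in K n x : x \in K -> avoid K n x = 0.
Proof. by case: n => [|n] xK; rewrite /avoid /= /kill xK. Qed.

Lemma kill_le K f g : (forall x, f x <= g x) -> forall x, kill K f x <= kill K g x.
Proof.
move=> fg x; rewrite /kill; case: ifP => // _.
by apply: ler_sum => y _; apply: ler_wpM2l.
Qed.

Lemma iter_kill_le K n f g : (forall x, f x <= g x) ->
  forall x, iter n (kill K) f x <= iter n (kill K) g x.
Proof. by move=> fg; elim: n => //= n IH; apply: kill_le. Qed.

Lemma eq_kill K f g x : (forall x, f x = g x) -> kill K f x = kill K g x.
Proof. by move=> fg; congr (if _ then _ else _); apply: eq_bigr => y _; rewrite fg. Qed.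

Lemma killD K f g x : kill K (fun y => f y + g y) x = kill K f x + kill K g x.
Proof.
rewrite /kill; case: ifP => _; rewrite ?addr0 // -big_split /=.
by apply: eq_bigr => y _; rewrite mulrDr.
Qed.

Lemma killZ K c f x : kill K (fun y => c * f y) x = c * kill K f x.
Proof.
rewrite /kill; case: ifP => _; rewrite ?mulr0 // big_distrr /=.
by apply: eq_bigr => y _; rewrite mulrCA.
Qed.

Lemma iter_killD K n f g x :
  iter n (kill K) (fun y => f y + g y) x = iter n (kill K) f x + iter n (kill K) g x.
Proof.
by elim: n x => //= n IH x; rewrite -killD; apply: eq_kill.
Qed.

Lemma iter_killZ K n c f x :
  iter n (kill K) (fun y => c * f y) x = c * iter n (kill K) f x.
Proof. by elim: n x => //= n IH x; rewrite -killZ; apply: eq_kill. Qed.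

Lemma avoidD K m n x : avoid K (m + n) x = iter m (kill K) (avoid K n) x.
Proof. by rewrite /avoid iterD. Qed.

Lemma avoid_ge0 K n x : 0 <= avoid K n x.
Proof.
elim: n x => [|n IH] x; first by rewrite /avoid /= ler0n.
rewrite avoidS /kill; case: ifP => // _.
by apply: sumr_ge0 => y _; rewrite mulr_ge0.
Qed.

Lemma avoidS_le K n x : avoid K n.+1 x <= avoid K n x.
Proof.
elim: n x => [|n IH] x; last by rewrite 2!avoidS; apply: kill_le.
rewrite avoidS /avoid /= /kill; case: ifP => //= _.
rewrite -[leRHS](p_sum1 x); apply: ler_sum => y _.
by rewrite ler_piMr // lern1 leq_b1.
Qed.

Lemma avoid_le K m n x : (m <= n)%N -> avoid K n x <= avoid K m x.
Proof.
move=> /subnK <-; elim: (n - m)%N => // k IH.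
by rewrite addSn; apply: le_trans IH; apply: avoidS_le.
Qed.

Lemma avoid_le1 K n x : avoid K n x <= 1.
Proof.
by apply: le_trans (avoid_le _ _ (leq0n n)) _; rewrite /avoid /= lern1 leq_b1.
Qed.

(** By monotonicity: [c * avoid K n] is the iterate started from [c] times the indicator of the
    complement of [K]. Pointwise bounds thus become bounds relative to the survival probability. *)
Lemma iter_kill_le_avoid K n c f :
  (forall x, f x <= c) -> (forall x, x \in K -> f x <= 0) ->
  forall x, iter n (kill K) f x <= c * avoid K n x.
Proof.
move=> fc f0 x; rewrite -iter_killZ; apply: iter_kill_le => y.
by case: (boolP (y \in K)) => yK; rewrite ?mulr0 ?mulr1 ?f0.
Qed.

Lemma avoidD_le K m n c : (forall x, avoid K n x <= c) ->
  forall x, avoid K (m + n) x <= c * avoid K m x.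
Proof.
move=> hc x; rewrite avoidD; apply: iter_kill_le_avoid => // y yK.
by rewrite avoid_in.
Qed.

Lemma kill_cst_le K c x : 0 <= c -> kill K (fun=> c) x <= c.
Proof.
move=> c0; rewrite /kill; case: ifP => // _.
by rewrite -big_distrl /= p_sum1 mul1r.
Qed.

Section Hitting.
Variables B G : {set S}.
Let h := avoid G.
Let u := avoid (B :|: G).

(* Decomposition at the first visit to [B :|: G] within [n] steps; likewise in
   the next two lemmas. *)
Lemma avoid_first_visit_le (c : R) (n k : nat) : 0 <= c ->
  (forall x, x \in B -> h k x <= c) ->
  forall y, h (n + k) y <= u n y + c.
Proof.
move=> c0 hc; elim: n => [|n IH] y.
  case: (boolP (y \in B :|: G)) => [|yK].
    rewrite inE => /orP[yB|yG].
      by apply: le_trans (hc _ yB) _; rewrite lerDr avoid_ge0.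
    by rewrite /h avoid_in // addr_ge0 // avoid_ge0.
  have -> : u 0%N y = 1 by rewrite /u /avoid /= yK.
  by apply: le_trans (avoid_le1 _ _ _) _; rewrite lerDl.
case: (boolP (y \in G)) => yG; first by rewrite /h avoid_in // addr_ge0 ?avoid_ge0.
case: (boolP (y \in B)) => yB.
  apply: le_trans (_ : c <= _); last by rewrite lerDr avoid_ge0.
  by apply: le_trans (hc _ yB); apply: avoid_le; rewrite leq_addl.
rewrite /h addSn avoidS; apply: le_trans (kill_le G IH y) _.
rewrite killD lerD ?kill_cst_le //.
by rewrite /u avoidS /kill inE (negbTE yG) (negbTE yB).
Qed.

Lemma avoid_first_visit_sub (e : R) (n k l m : nat) : 0 <= e ->
  (n + l <= m)%N ->
  (forall x, x \in B -> 1 - e <= h m x) ->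
  forall y, h (n + k) y - h (n + l) y <= u n y + e.
Proof.
move=> e0 + he; elim: n => [|n IH] lm y; case: (boolP (y \in G)) => yG;
  (try by rewrite /h !avoid_in // subr0 addr_ge0 ?avoid_ge0);
  (* From a point of [B], survival for [n + l <= m] steps has probability at least [1 - e], while
     [h (n + k) y <= 1]. *)
  case: (boolP (y \in B)) => yB; try (
  apply: (@le_trans _ _ e); [|by rewrite lerDr avoid_ge0];
  have := he _ yB; have /(_ G y) := avoid_le _ _ lm; rewrite -/h;
  set a := h _ _; set b := h _ _; set c := h _ _; have : c <= 1 := avoid_le1 _ _ _; lra).
  have -> : u 0%N y = 1 by rewrite /u /avoid /= inE negb_or yB yG.
  rewrite -lerBlDl; have := avoid_ge0 G (0 + l) y; have := avoid_le1 G (0 + k) y.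
  rewrite /h; lra.
have := IH (ltnW lm); move=> /(kill_le G)/(_ y); rewrite !killD.
have -> : kill G (fun z => - h (n + l) z) y = - h (n.+1 + l) y.
  by rewrite -[RHS]mulN1r [h _ y]avoidS -killZ; apply: eq_kill => z; rewrite mulN1r.
have -> : kill G (u n) y = u n.+1 y.
  by rewrite [RHS]avoidS /kill inE (negbTE yG) (negbTE yB).
rewrite -[kill G (h _) y]/(h (n.+1 + k) y).
have := kill_cst_le G y e0; lra.
Qed.

Lemma avoid_first_visit_ge (c : R) (n s t : nat) : 0 <= c -> (n + s <= t)%N ->
  (forall x, x \in B -> c <= h t x) ->
  forall y, (h n y - u n y) * c <= h (n + s) y.
Proof.
move=> c0 + hc; elim: n => [|n IH] nt y; case: (boolP (y \in G)) => yG;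
  (try by rewrite /h /u !avoid_in ?inE ?yG ?orbT // subrr mul0r).
- case: (boolP (y \in B)) => yB.
    rewrite /u avoid_in ?inE ?yB // subr0.
    apply: (@le_trans _ _ c); first by rewrite ler_piMl // avoid_le1.
    by apply: le_trans (hc _ yB) _; apply: avoid_le.
  rewrite /h /u /avoid /= inE negb_or yG yB subrr mul0r; exact: avoid_ge0.
- case: (boolP (y \in B)) => yB.
    rewrite /u avoid_in ?inE ?yB // subr0.
    apply: (@le_trans _ _ c); first by rewrite ler_piMl // avoid_le1.
    by apply: le_trans (hc _ yB) _; apply: avoid_le.
  have := IH (ltnW nt); move=> /(kill_le G)/(_ y); apply: le_trans.
  have -> : u n.+1 y = kill G (u n) y.
    by rewrite [LHS]avoidS /kill inE (negbTE yG) (negbTE yB).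
  rewrite [h _ y]avoidS -mulN1r -killZ -killD mulrC -killZ le_eqVlt; apply/orP; left; apply/eqP.
  by apply: eq_kill => z; rewrite mulrC mulN1r.
Qed.

End Hitting.
End KilledChain.

Section FreeChain.
Variables (R : realType) (S : finType) (p : S -> S -> R).
Hypothesis p_ge0 : forall x y, 0 <= p x y.
Hypothesis p_sum1 : forall x, \sum_y p x y = 1.

Lemma iter_kill_ge0 (K : {set S}) (n : nat) (f : S -> R) :
  (forall x, 0 <= f x) -> forall x, 0 <= iter n (kill p K) f x.
Proof.
move=> f0; elim: n => //= n IH x; rewrite /kill; case: ifP => // _.
by apply: sumr_ge0 => y _; rewrite mulr_ge0.
Qed.

Lemma iter_kill_set0 (K : {set S}) (n : nat) (f : S -> R) :
  (forall x, 0 <= f x) ->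
  forall x, iter n (kill p K) f x <= iter n (kill p finset.set0) f x.
Proof.
move=> f0; elim: n => //= n IH x.
apply: le_trans (kill_le p_ge0 K IH x) _.
rewrite /kill finset.in_set0; case: ifP => // _.
by apply: sumr_ge0 => y _; rewrite mulr_ge0 ?iter_kill_ge0.
Qed.

Lemma iter_kill_set0_cst (n : nat) (c : R) x :
  iter n (kill p finset.set0) (fun=> c) x = c.
Proof.
elim: n x => //= n IH x; rewrite (eq_kill _ _ _ IH) /kill finset.in_set0.
by rewrite -big_distrl /= p_sum1 mul1r.
Qed.

(* The killed and the free evolution differ only on the event of being killed. *)
Lemma iter_kill_set0_le (G : {set S}) (n : nat) (f : S -> R) :
  (forall x, f x <= 1) -> (forall x, x \in G -> f x = 0) ->
  forall x, iter n (kill p finset.set0) f x <=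
            iter n (kill p G) f x + (1 - avoid p G n x).
Proof.
move=> f1 fG x.
(* Positivity is applied to [1 - f]: its killed expectation is at most its free one, and the free
   evolution preserves constants. *)
have f1' y : 0 <= 1 + -1 * f y by rewrite mulN1r subr_ge0.
have := iter_kill_set0 G n f1' x.
rewrite !iter_killD iter_kill_set0_cst !iter_killZ.
have : avoid p G n x <= iter n (kill p G) (fun=> 1) x.
  by apply: iter_kill_le => // y; rewrite lern1 leq_b1.
lra.
Qed.

End FreeChain.

(** * Approximate multiplicativity of survival for a discrete-time chain *)

Section DiscreteChain.
Variables (R : realType) (S : finType) (p : S -> S -> R).
Hypothesis p_ge0 : forall x y, 0 <= p x y.
Hypothesis p_sum1 : forall x, \sum_y p x y = 1.
(** The unit of time is [N] steps. The errors are [e] for hitting [G] from [B] within two units, [d]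
    for the dependence on the starting point in [B] after one unit, [r] for meeting neither [B] nor
    [G] during one unit, and [th] for hitting [G] from [nu] within one unit. *)
Variables (B G : {set S}) (N : nat) (nu : S -> R) (e d r th : R).
Hypothesis disjBG : forall x, x \in B -> x \notin G.
Hypotheses (e0 : 0 <= e) (d0 : 0 <= d) (r0 : 0 <= r) (th0 : 0 <= th).
Hypotheses (th_le : th <= 2^-1) (er_le : r + e <= 4^-1).
Hypothesis escape : forall x, x \in B -> 1 - e <= avoid p G (2 * N) x.
Hypothesis mixing : forall x x', x \in B -> x' \in B ->
  forall f : S -> R, (forall y, 0 <= f y <= 1) ->
  iter N (kill p finset.set0) f x <= iter N (kill p finset.set0) f x' + d.
Hypothesis recur : forall x, avoid p (B :|: G) N x <= r.
Hypothesis nu_law : is_law nu.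
Let h k x := avoid p G (k * N) x.
Let a k := \sum_x nu x * h k x.
Hypothesis start : 1 - th <= a 1.

Let nu_ge0 x : 0 <= nu x. Proof. by case: nu_law. Qed.
Let nu_sum1 : \sum_x nu x = 1. Proof. by case: nu_law. Qed.

Let h_ge0 k x : 0 <= h k x. Proof. exact: avoid_ge0. Qed.
Let h_le1 k x : h k x <= 1. Proof. exact: avoid_le1. Qed.

Let nu_le f g : (forall x, f x <= g x) -> \sum_x nu x * f x <= \sum_x nu x * g x.
Proof. by move=> fg; apply: ler_sum => x _; apply: ler_wpM2l. Qed.

Let a_ge0 k : 0 <= a k.
Proof. by apply: sumr_ge0 => x _; rewrite mulr_ge0. Qed.

Let a_le1 k : a k <= 1.
Proof. by rewrite -nu_sum1; apply: ler_sum => x _; rewrite ler_piMr. Qed.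

Let a_lin (c c' : R) k k' :
  \sum_x nu x * (c * h k x + c' * h k' x) = c * a k + c' * a k'.
Proof.
rewrite /a !big_distrr -big_split /=; apply: eq_bigr => x _.
by rewrite mulrDr !(mulrCA (nu x)).
Qed.

Let a_noninc k : a k.+1 <= a k.
Proof. by apply: nu_le => x; apply: avoid_le => //; rewrite leq_mul2r leqnSn orbT. Qed.

(** If [B] were empty, avoiding [B :|: G] would mean avoiding [G], so [a 1 <= r <= 1/4], against
    [a 1 >= 1 - th >= 1/2]. *)
Let B_neq0 : exists x, x \in B.
Proof.
have [B0|[x xB]] := finset.set_0Vmem B; last by exists x.
have : a 1 <= r.
  have -> : r = \sum_x nu x * r by rewrite -big_distrl /= nu_sum1 mul1r.
  by apply: nu_le => x; have := recur x; rewrite B0 finset.set0U /h mul1n.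
by move: start th_le er_le e0; lra.
Qed.

Section Reference.
Variables (x0 : S) (x0B : x0 \in B).
Let b k := h k x0.

Let h0B x : x \in B -> h 0 x = 1.
Proof. by move=> /disjBG xG; rewrite /h mul0n /avoid /= xG. Qed.

Let escape1 x : x \in B -> 1 - e <= avoid p G N x.
Proof.
move=> xB; apply: le_trans (escape xB) _.
by apply: avoid_le => //; rewrite leq_pmull.
Qed.

(** Drop the killing during the first unit, compare the free laws by mixing, then restore the
    killing, which costs at most [e] by escape from [B]. *)
Let osc_le k x x' : x \in B -> x' \in B -> h k x <= h k x' + (d + e).
Proof.
move=> xB x'B; case: k => [|k]; first by rewrite !h0B // lerDl addr_ge0.
rewrite /h mulSn !avoidD.
apply: le_trans (iter_kill_set0 p_ge0 _ _ (fun y => avoid_ge0 p_ge0 G (k * N) y) x) _.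
apply: le_trans (mixing xB x'B _) _ => [y|]; first by rewrite avoid_ge0 ?avoid_le1.
have := @iter_kill_set0_le _ _ _ p_ge0 p_sum1 G N (avoid p G (k * N)) _ _ x'.
move=> /(_ (fun y => avoid_le1 p_ge0 p_sum1 _ _ _)).
move=> /(_ (fun y => @avoid_in _ _ _ _ _ y)).
have := escape1 x'B; lra.
Qed.

(** Either [B :|: G] is not met in the first unit, or [G] must be hit after a visit to [B]. The
    visit can occur at any time of the first unit, so the end of the second may be two units away:
    this is why escape is assumed over [2 * N] steps. *)
Let dropN y : avoid p G N y - avoid p G (2 * N) y <= r + e.
Proof.
apply: le_trans (_ : avoid p (B :|: G) N y + e <= _); last by rewrite lerD2r.
have := @avoid_first_visit_sub _ _ _ p_ge0 p_sum1 B G e N 0 N (2 * N) e0.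
by rewrite addn0 addnn -mul2n; apply.
Qed.

Let drop k y : h k.+1 y - h k.+2 y <= (r + e) * h k y.
Proof.
have E : h k.+1 y - h k.+2 y =
    iter (k * N) (kill p G) (fun z => avoid p G N z + -1 * avoid p G (2 * N) z) y.
  by rewrite iter_killD iter_killZ -!avoidD mulN1r -mulnDl addn2 -mulSnr.
rewrite E; apply: iter_kill_le_avoid => // z.
  by rewrite mulN1r.
by move=> zG; rewrite !avoid_in // mulr0 addr0.
Qed.

Let dropB k : b k <= b k.+1 + (r + e).
Proof.
case: k => [|k].
  rewrite /b h0B // -lerBlDr; apply: le_trans (_ : 1 - e <= _).
    by rewrite lerD2l lerN2 lerDr.
  by rewrite /h mul1n; apply: escape1.
rewrite -lerBlDl; apply: le_trans (drop _ _) _.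
by rewrite ler_piMr // addr_ge0.
Qed.

(** Failing to reach [B :|: G] in the first unit costs [r], replacing the point reached in [B] by
    [x0] costs [d + e], and restoring the unit spent costs [r + e] by [dropB]. *)
Let upper k z : h k z <= b k + (2 * r + 2 * e + d).
Proof.
case: k => [|k].
  by apply: le_trans (h_le1 _ _) _; rewrite /b h0B // lerDl !addr_ge0 // mulr_ge0.
have := @avoid_first_visit_le _ _ _ p_ge0 p_sum1 B G (b k + (d + e)) N (k * N) _ _ z.
rewrite -mulSn => H.
have {H} : h k.+1 z <= avoid p (B :|: G) N z + (b k + (d + e)).
  by apply: H => [|x xB]; [rewrite !addr_ge0 ?h_ge0|apply: osc_le].
have := recur z; have := dropB k; lra.
Qed.

(** A lower bound for survival from every point of [B], truncated at 0 because the first-visit lower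
    bound multiplies by a nonnegative constant. *)
Let c k := Num.max 0 (b k - (d + e)).

Let c_ge0 k : 0 <= c k. Proof. by rewrite le_max lexx. Qed.

Let c_geb k : b k - (d + e) <= c k. Proof. by rewrite le_max lexx orbT. Qed.

Let c_le1 k : c k <= 1.
Proof. by rewrite ge_max ler01 /= lerBlDr (le_trans (h_le1 _ _)) // lerDl addr_ge0. Qed.

Let c_le k x : x \in B -> c k <= h k x.
Proof. by move=> xB; rewrite ge_max h_ge0 lerBlDr osc_le. Qed.

(** Survive [j] units, visit [B] before [G] in the next one, then survive to the end. The visit may
    come at the very start of that unit, hence [c k.+1] and not [c k]. *)
Let lower j k z : (h j.+1 z - r * h j z) * c k.+1 <= h (j.+1 + k) z.
Proof.
(* The error [r] is written [r * avoid p G 0 y], so that [j] units of killed evolution turn it into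
   [r * h j z], an error relative to survival. *)
have H : forall y, c k.+1 * (avoid p G N y + - r * avoid p G 0 y) <= avoid p G (k.+1 * N) y.
  move=> y; have := @avoid_first_visit_ge _ _ _ p_ge0 p_sum1 B G (c k.+1) N (k * N) (k.+1 * N).
  rewrite -mulSn leqnn => /(_ (c_ge0 _) isT (fun x xB => c_le _ xB) y); apply: le_trans.
  rewrite mulrC ler_wpM2r // lerD2l mulNr lerN2.
  have [yG|yG] := boolP (y \in G); first by rewrite !avoid_in ?inE ?yG ?orbT // mulr0.
  by rewrite [avoid p G 0 y]/avoid /= yG mulr1.
have := iter_kill_le p_ge0 G (j * N) H z.
rewrite iter_killZ iter_killD iter_killZ -!avoidD addn0 -mulSnr -mulnDl.
by rewrite addnS -addSn mulrC mulNr.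
Qed.

Let a_upper j k : a (j + k) <= (b k + (2 * r + 2 * e + d)) * a j.
Proof.
have := a_lin (b k + (2 * r + 2 * e + d)) 0 j j; rewrite mul0r addr0 => <-.
apply: nu_le => x; rewrite mul0r addr0 /h mulnDl.
by apply: avoidD_le => // y; apply: upper.
Qed.

Let a_lower j k : (a j.+1 - r * a j) * c k.+1 <= a (j.+1 + k).
Proof.
have -> : (a j.+1 - r * a j) * c k.+1 = c k.+1 * a j.+1 + (- r * c k.+1) * a j by lra.
rewrite -a_lin; apply: nu_le => x.
by apply: le_trans (lower j k x); lra.
Qed.

(** One unit loses at most [(r + e) * a j], which by induction is at most half of [a j.+1]. Errors
    proportional to [a j] can thus be charged to [a j.+1]. *)
Let half j : a j <= 2 * a j.+1.
Proof.
elim: j => [|j IH].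
  by have := a_le1 0; move: start th_le; lra.
have D : a j.+1 - a j.+2 <= (r + e) * a j.
  have := a_lin 1 (-1) j.+1 j.+2; rewrite mul1r mulN1r => <-.
  have := a_lin (r + e) 0 j j; rewrite mul0r addr0 => <-.
  by apply: nu_le => x; rewrite mul0r addr0 mul1r mulN1r.
have : (r + e) * a j <= 4^-1 * (2 * a j.+1) by apply: ler_pM => //; apply: addr_ge0.
lra.
Qed.

(** From [nu] the chain visits [B] before [G] within one unit, except with probability [th + r];
    from there it survives like the reference point up to [d + e]. This is [a_lower] at [j = 0]. *)
Let b_le_a k : b k <= a k + (d + e + th + r).
Proof.
case: k => [|k].
  by rewrite /b h0B //; have := start; have := a_noninc 0; move: e0 d0 r0 th0 er_le; lra.
have := a_lower 0 k; rewrite add1n.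
have : (1 - th - r) * c k.+1 <= (a 1 - r * a 0) * c k.+1.
  apply: ler_wpM2r => //; have : r * a 0 <= r by rewrite ler_piMr ?a_le1.
  have := start; move: e0 d0 r0 th0 er_le; lra.
have : (th + r) * c k.+1 <= th + r by rewrite ler_piMr // addr_ge0.
have := c_geb k.+1; move: e0 d0 r0 th0 er_le; lra.
Qed.

(** The constant 5 counts the occurrences of [r] in the lower bound: three in comparing [a k] with
    [c k.+1], two more from [half]. Every other error occurs less often. *)
Lemma approx_mul_ref j k :
  `|a (j + k) - a j * a k| <= 5 * (e + d + r + th) * a j.
Proof.
rewrite ler_norml; apply/andP; split; last first.
  have := a_upper j k.
  have : (b k + (2 * r + 2 * e + d)) * a j <= (a k + 5 * (e + d + r + th)) * a j.
    by apply: ler_wpM2r => //; have := b_le_a k; move: e0 d0 r0 th0 er_le; lra.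
  move: e0 d0 r0 th0 er_le; lra.
(* The lower bound spends one unit on returning to [B], so [j = 0] is treated apart, by
   [a 0 <= 1]. *)
case: j => [|j].
  rewrite add0n; have : a 0 * a k <= a k by rewrite ler_piMl.
  have : 0 <= 5 * (e + d + r + th) * a 0 by rewrite !mulr_ge0 // !addr_ge0.
  move: e0 d0 r0 th0 er_le; lra.
have ck : a k - (2 * r + 2 * e + d) - (r + e) - (d + e) <= c k.+1.
  have := c_geb k.+1; have := dropB k; have := a_upper 0 k; rewrite add0n.
  have : (b k + (2 * r + 2 * e + d)) * a 0 <= b k + (2 * r + 2 * e + d).
    by rewrite ler_piMr // !addr_ge0 ?mulr_ge0 ?h_ge0.
  move: e0 d0 r0 th0 er_le; lra.
have := a_lower j k.
have H1 : a j.+1 * (1 - 2 * r) * c k.+1 <= (a j.+1 - r * a j) * c k.+1.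
  by apply: ler_wpM2r => //; have := ler_wpM2l r0 (half j); move: e0 d0 r0 th0 er_le; lra.
have H2 : a j.+1 * (c k.+1 - 2 * r) <= a j.+1 * (1 - 2 * r) * c k.+1.
  rewrite -mulrA ler_wpM2l //.
  have : 2 * r * c k.+1 <= 2 * r by rewrite ler_piMr // mulr_ge0.
  by lra.
have H3 : a j.+1 * (a k - 5 * (e + d + r + th)) <= a j.+1 * (c k.+1 - 2 * r).
  by rewrite ler_wpM2l //; move: e0 d0 r0 th0 er_le; lra.
move: e0 d0 r0 th0 er_le; lra.
Qed.

End Reference.

Lemma avoid_approx_mul j k :
  `|a (j + k) - a j * a k| <= 5 * (e + d + r + th) * a j.
Proof. by have [x xB] := B_neq0; exact: approx_mul_ref xB j k. Qed.

End DiscreteChain.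

(** * Nearly multiplicative sequences *)

Section Renewal.
Variables (R : realType) (a : nat -> R) (kappa L : R).
Hypothesis aM : forall j k, `|a (j + k)%N - a j * a k| <= kappa * a j.
Hypothesis sum_a : series a @ \oo --> L.
Hypothesis L_ge1 : 1 <= L.

Let L_gt0 : 0 < L. Proof. exact: lt_le_trans L_ge1. Qed.

(* Sum the approximate multiplicativity over the first argument. *)
Lemma tail_near (k : nat) : `|(1 - series a k / L) - a k| <= kappa.
Proof.
have tl : (fun n => series a (n + k)%N - series a k - series a n * a k) @ \oo
    --> L - series a k - L * a k.
  apply: cvgB; first (apply: cvgB; last exact: cvg_cst).
    by rewrite (cvg_shiftn k (series a)).
  by apply: cvgM => //; exact: cvg_cst.
have tr : (fun n => kappa * series a n) @ \oo --> kappa * L.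
  by apply: cvgM => //; exact: cvg_cst.
have E n : `|series a (n + k)%N - series a k - series a n * a k| <= kappa * series a n.
  have -> : series a (n + k)%N - series a k = \sum_(0 <= j < n) a (j + k)%N.
    rewrite /series /= addnC (@big_cat_nat _ _ _ k 0 (k + n)) //= ?leq_addr // addrAC subrr add0r.
    by rewrite -{1}(add0n k) big_addn addKn; apply: eq_bigr.
  rewrite /series /= mulr_suml -sumrB mulr_sumr.
  apply: le_trans (ler_norm_sum _ _ _) _.
  by apply: ler_sum => j _.
have : `|L - series a k - L * a k| <= kappa * L.
  apply: (@ler_cvg_to _ \oo _ _ _ _ _ _ (cvg_norm tl) tr).
  by near=> n; apply: E.
have -> : L - series a k - L * a k = L * (1 - series a k / L - a k).
  by field; rewrite gt_eqF.
by rewrite normrM gtr0_norm // mulrC ler_pM2r.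
Unshelve. all: by end_near.
Qed.

Lemma near_geometric (k : nat) : `|a k - (1 - L^-1) ^+ k| <= 2 * kappa.
Proof.
have Li : 0 <= L^-1 <= 1 by rewrite invr_ge0 ltW //= invf_le1.
have V n : `|1 - series a n / L - (1 - L^-1) ^+ n| <= kappa.
  elim: n => [|n IH].
    rewrite /series /= big_geq // mul0r subr0 expr0 subrr normr0.
    by apply: le_trans (tail_near 0).
  (* The new error is a convex combination of the old one and of the error in [tail_near], both at
     most [kappa]; hence errors do not accumulate. The second [kappa] of the statement comes from
     replacing the tail by [a k]. *)
  have -> : 1 - series a n.+1 / L - (1 - L^-1) ^+ n.+1 =
      (1 - L^-1) * (1 - series a n / L - (1 - L^-1) ^+ n) +
      L^-1 * (1 - series a n / L - a n).
    by rewrite /series /= big_nat_recr //= exprS; ring.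
  apply: le_trans (ler_normD _ _) _.
  rewrite !normrM [`|L^-1|]ger0_norm ?[`|1 - L^-1|]ger0_norm; try lra.
  have -> : kappa = (1 - L^-1) * kappa + L^-1 * kappa by ring.
  by apply: lerD; apply: ler_wpM2l; rewrite ?tail_near //; lra.
have := tail_near k; have := V k; rewrite !ler_norml; lra.
Qed.

End Renewal.

(** Squeeze through [expR (- (z / (1 - z))) <= 1 - z <= expR (- z)] for [0 < z < 1]; both bounds
    come from [1 + x <= expR x]. *)
Lemma cvg_expr_expR (R : realType) (y : nat -> R) (k : nat -> nat) (t : R) :
  (\forall n \near \oo, 0 < y n) -> y @ \oo --> (0 : R) ->
  (fun n => (k n)%:R * y n) @ \oo --> t ->
  (fun n => (1 - y n) ^+ k n) @ \oo --> expR (- t).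
Proof.
move=> y_gt0 y0 kt.
have y1 : \forall n \near \oo, y n < 1 by apply: (cvgr_lt _ y0).
apply: (@squeeze_cvgr _ _ _ _ (fun n => expR (- ((k n)%:R * y n / (1 - y n))))
   (fun n => expR (- ((k n)%:R * y n)))).
- near=> n.
  have yn1 : y n < 1 by near: n.
  have yn0 : 0 < 1 - y n by rewrite subr_gt0.
  have E z : expR (- ((k n)%:R * z)) = expR (- z) ^+ k n by rewrite -mulrN expRM_natl.
  rewrite -mulrA !E; apply/andP; split; last first.
    by rewrite lerXn2r ?nnegrE ?expR_ge0 ?(ltW yn0) ?expR_ge1Dx.
  rewrite lerXn2r ?nnegrE ?expR_ge0 ?(ltW yn0) //.
  rewrite expRN invf_ple ?posrE ?expR_gt0 //.
  apply: le_trans (expR_ge1Dx _); rewrite le_eqVlt; apply/orP; left; apply/eqP.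
  by field; rewrite gt_eqF.
- apply: continuous_cvg; first exact: continuous_expR.
  apply: cvgN; rewrite -[t]divr1; apply: cvgM => //.
  apply: cvgV; first by rewrite oner_neq0.
  by rewrite -[X in _ --> X]subr0; apply: cvgB => //; exact: cvg_cst.
- by apply: continuous_cvg; [exact: continuous_expR|exact: cvgN].
Unshelve. all: by end_near.
Qed.

(* The sums of the first [k] terms satisfy [s_n <= s_(n + k) <= k + q s_n]. *)
Lemma cvg_series_of_contraction (R : realType) (a : nat -> R) (k : nat) (q : R) :
  (forall j, 0 <= a j <= 1) -> q < 1 -> (forall j, a (j + k)%N <= q * a j) ->
  cvgn (series a).
Proof.
move=> a01 q1 aq.
have nd : nondecreasing_seq (series a).
  by apply: nondecreasing_series => n _ _; case/andP: (a01 n).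
apply: nondecreasing_is_cvgn => //; exists (k%:R / (1 - q)) => _ [n _ <-].
rewrite ler_pdivlMr ?subr_gt0 //.
suff : series a n <= k%:R + q * series a n by lra.
apply: le_trans (nd _ _ (leq_addl k n)) _.
rewrite /series /= (@big_cat_nat _ _ _ k 0 (k + n)) //= ?leq_addr //; apply: lerD.
  rewrite -[X in X%:R]subn0 -sumr_const_nat.
  by apply: ler_sum => i _; case/andP: (a01 i).
rewrite -{1}(add0n k) big_addn addKn mulr_sumr.
by apply: ler_sum => i _.
Qed.

(* [k n] is the number of time units in [t] expectations, an expectation being
   [L n] units up to one unit. *)
Lemma cvg_geometric_expR (R : realType) (a : nat -> nat -> R)
    (kappa L : nat -> R) (k : nat -> nat) (t : R) :
  (forall n j, 0 <= a n j <= 1) ->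
  (\forall n \near \oo, forall i j,
     `|a n (i + j)%N - a n i * a n j| <= kappa n * a n i) ->
  (\forall n \near \oo, 1 - kappa n <= a n 1%N /\ 1 - kappa n <= a n 0%N) ->
  kappa @ \oo --> (0 : R) ->
  (forall n, series (a n) @ \oo --> L n) ->
  0 <= t -> (\forall n \near \oo, `|(k n)%:R - t * L n| <= t + 1) ->
  (fun n => a n (k n)) @ \oo --> expR (- t).
Proof.
move=> a01 aM a1 kappa0 sum_a t0 kL.
have kappa_small : \forall n \near \oo, kappa n < 2^-1.
  by apply: (cvgr_lt _ kappa0); rewrite invr_gt0.
have L_ge n j : series (a n) j <= L n.
  rewrite -(cvg_lim _ (sum_a n)) //; apply: nondecreasing_cvgn_le.
    by apply: nondecreasing_series => i _ _; case/andP: (a01 n i).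
  by apply/cvg_ex; exists (L n); exact: sum_a.
have L_ge1 : \forall n \near \oo, 1 <= L n.
  near=> n; apply: le_trans (L_ge n 2).
  have [A1 A0] : 1 - kappa n <= a n 1%N /\ 1 - kappa n <= a n 0%N by near: n.
  have : kappa n < 2^-1 by near: n.
  by rewrite /series /= big_nat_recr //= big_nat1; lra.
have L_gt0 : \forall n \near \oo, 0 < L n.
  by near=> n; apply: lt_le_trans (_ : 1 <= _) => //; near: n.
(* The expectation diverges in units: [tail_near] at 1 gives [a n 0 / L n <= 1 - a n 1 + kappa n <=
   2 * kappa n], and [a n 0 >= 1/2]. *)
have Li0 : (fun n => (L n)^-1) @ \oo --> (0 : R).
  apply: (@squeeze_cvgr _ _ _ _ (fun=> 0) (fun n => 4 * kappa n)).
  - near=> n.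
    have [A1 A0] : 1 - kappa n <= a n 1%N /\ 1 - kappa n <= a n 0%N by near: n.
    have Ln : 1 <= L n by near: n.
    have kn : kappa n < 2^-1 by near: n.
    have an : forall i j, `|a n (i + j)%N - a n i * a n j| <= kappa n * a n i by near: n.
    have a0 i : 0 <= a n i by case/andP: (a01 n i).
    have Li : 0 <= (L n)^-1 by rewrite invr_ge0; lra.
    rewrite Li /=; have := tail_near an (sum_a n) Ln 1.
    rewrite ler_norml /series /= big_nat1.
    have : 2^-1 * (L n)^-1 <= a n 0%N * (L n)^-1 by apply: ler_wpM2r => //; lra.
    lra.
  - exact: cvg_cst.
  - by rewrite -[X in _ --> X](mulr0 4); apply: cvgM => //; exact: cvg_cst.
have kL' : (fun n => (k n)%:R * (L n)^-1) @ \oo --> t.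
  have t1 : 0 < t + 1 by lra.
  apply/cvgrPdist_le => eps eps0; near=> n.
  have Ln : 0 < L n by near: n.
  have kn : `|(k n)%:R - t * L n| <= t + 1 by near: n.
  have -> : t - (k n)%:R * (L n)^-1 = - (((k n)%:R - t * L n) * (L n)^-1).
    by field; rewrite gt_eqF.
  rewrite normrN normrM [`|_^-1|]gtr0_norm ?invr_gt0 //.
  apply: le_trans (ler_wpM2r _ kn) _; first by rewrite invr_ge0 ltW.
  rewrite mulrC -ler_pdivlMr //; near: n.
  by apply: (cvgr_le _ Li0); rewrite divr_gt0.
have Li_gt0 : \forall n \near \oo, 0 < (L n)^-1.
  by near=> n; rewrite invr_gt0; near: n.
have geo := cvg_expr_expR Li_gt0 Li0 kL'.
have dif : (fun n => a n (k n) - (1 - (L n)^-1) ^+ k n) @ \oo --> (0 : R).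
  apply/cvgrPdist_le => eps eps0; near=> n.
  have Ln : 1 <= L n by near: n.
  have an : forall i j, `|a n (i + j)%N - a n i * a n j| <= kappa n * a n i by near: n.
  rewrite sub0r normrN.
  apply: le_trans (near_geometric an (sum_a n) Ln (k n)) _.
  rewrite mulrC -ler_pdivlMr //; near: n.
  by apply: (cvgr_le _ kappa0); rewrite divr_gt0.
rewrite -[expR _]add0r; apply: cvg_trans (cvgD dif geo).
by apply: near_eq_cvg; apply: nearW => n /=; rewrite subrK.
Unshelve. all: by end_near.
Qed.

(** * Finite-dimensional laws and hitting times *)

Section FiniteValued.
Variables (R : realType) (S : finType) (d : measure_display)
  (Omega : measurableType d) (P : probability Omega R) (Z : Omega -> S).
Hypothesis Z_meas : forall x, measurable [set w | Z w = x].

Lemma measurable_finite_mem (s : pred S) : measurable [set w | s (Z w)].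
Proof.
rewrite (_ : [set w | _] = \bigcup_(x in [set` s]) [set w | Z w = x]).
  by apply: fin_bigcup_measurable => //; exact: finite_finset.
by apply/seteqP; split=> w /=; [exists (Z w)|case=> x /= xs ->].
Qed.

Lemma measure_finite_partition (E : set Omega) (s : pred S) : measurable E ->
  P (E `&` [set w | s (Z w)]) = (\sum_(x | s x) P (E `&` [set w | Z w = x]))%E.
Proof.
move=> mE; have -> : E `&` [set w | s (Z w)] =
    E `&` [set w | Z w \in [seq x <- index_enum S | s x]].
  by apply/seteqP; split=> w /= [Ew]; rewrite mem_filter mem_index_enum andbT.
rewrite -big_filter; have : uniq [seq x <- index_enum S | s x].
  by rewrite filter_uniq // index_enum_uniq.
elim: [seq x <- _ | _] => [_|x l IH /= /andP[xl ul]].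
  rewrite big_nil (_ : _ `&` _ = set0) ?measure0 //.
  by apply/seteqP; split=> w //= [].
rewrite big_cons -IH // -measureU.
- congr (P _); apply/seteqP; split=> w /=.
    by rewrite inE => -[Ew /orP[/eqP|]]; [left|right].
  by case=> -[Ew H]; split=> //; rewrite inE ?H ?eqxx ?orbT.
- by apply: measurableI => //; exact: Z_meas.
- by apply: measurableI => //; exact: measurable_finite_mem.
- by apply/seteqP; split=> w //= [] [_ Zx] [_]; rewrite Zx (negbTE xl).
Qed.

End FiniteValued.

Section CylinderEvents.
Variables (R : realType) (S : finType) (d : measure_display)
  (Omega : measurableType d) (P : probability Omega R)
  (Q : S -> S -> R) (nu : S -> R) (X : R -> Omega -> S).
Hypothesis X_ctmc : is_ctmc P Q nu X.

Let Xm t x : 0 <= t -> measurable [set w | X t w = x].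
Proof. by move=> t0; apply: (ctmc_measurable X_ctmc). Qed.

Variables (t : nat -> R) (A : nat -> {set S}).
Hypothesis t0 : t 0%N = 0.

(* Conditional probability, given the state x at time [t i], of being in [A j]
   at time [t j] for all [i < j <= i + l]. *)
Fixpoint cylinder_weight (i l : nat) (x : S) : R :=
  if l is l'.+1 then
    \sum_(y in A i.+1) transition Q (t i.+1 - t i) x y * cylinder_weight i.+1 l' y
  else 1.

(** States are prescribed exactly up to index [i] and only up to sets at the [l] next indices.
    Induction on [l] trades a set for a sum over its points, down to the events whose probability
    the definition of the chain provides. *)
Let cyl (i l : nat) (x : nat -> S) :=
  [set w | (forall j, (j <= i)%N -> X (t j) w = x j) /\
           (forall j, (i < j <= i + l)%N -> X (t j) w \in A j)].

Let t_ge0 n : (forall i, (i < n)%N -> t i <= t i.+1) ->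
  forall i, (i <= n)%N -> 0 <= t i.
Proof.
move=> tn; elim=> [|i IH] li; first by rewrite t0.
by apply: le_trans (IH (ltnW li)) _; apply: tn.
Qed.

Let finite_itv m n : finite_set [set j | (m < j <= n)%N].
Proof. by apply: (@sub_finite_set _ _ `I_n.+1) => // j /= /andP[]. Qed.

Let cyl_meas i l x : (forall j, (j < i + l)%N -> t j <= t j.+1) -> measurable (cyl i l x).
Proof.
move=> ti; have tp := t_ge0 ti.
rewrite (_ : cyl i l x =
  (\bigcap_(j in `I_i.+1) [set w | X (t j) w = x j]) `&`
  (\bigcap_(j in [set j | (i < j <= i + l)%N]) [set w | X (t j) w \in A j])); last first.
  by apply/seteqP; split=> w /= -[H1 H2]; split=> j /= lj; first [exact: H1|exact: H2].
apply: measurableI; apply: fin_bigcap_measurable => // j /= lj.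
- by apply: Xm; apply: tp; apply: leq_trans (leq_addr _ _).
- apply: measurable_finite_mem => y; apply: Xm; apply: tp.
  by case/andP: lj.
Qed.

Let cyl_prob l : forall i x, (forall j, (j < i + l)%N -> t j <= t j.+1) ->
  P (cyl i l x) =
  (nu (x 0%N) * \prod_(j < i) transition Q (t j.+1 - t j) (x j) (x j.+1) *
   cylinder_weight i l (x i))%:E.
Proof.
elim: l => [|l IH] i x ti.
  rewrite mulr1 -(ctmc_fdd X_ctmc) //; last by rewrite addn0 in ti.
  congr (P _); apply/seteqP; split=> w /=; first by case.
  move=> H; split=> // j /andP[ij]; rewrite addn0 leqNgt ij //.
pose x' y j := if j == i.+1 then y else x j.
have x'E y j : (j <= i)%N -> x' y j = x j.
  by move=> ji; rewrite /x' ifF //; apply/eqP => E; rewrite E ltnn in ji.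
have x'S y : x' y i.+1 = y by rewrite /x' eqxx.
(* [E] is the event without the constraint at index [i.+1]; that constraint is then split according
   to the state there. *)
pose E := cyl i 0 x `&`
  \bigcap_(j in [set j | (i.+1 < j <= i.+1 + l)%N]) [set w | X (t j) w \in A j].
have tp := t_ge0 ti.
have mE : measurable E.
  apply: measurableI.
    by apply: cyl_meas => j; rewrite addn0 => ji; apply: ti; apply: ltn_addr.
  apply: fin_bigcap_measurable => // j /= /andP[_ lj].
  by apply: measurable_finite_mem => y; apply: Xm; apply: tp; rewrite addnS -addSn.
have -> : cyl i l.+1 x = E `&` [set w | X (t i.+1) w \in A i.+1].
  apply/seteqP; split=> w /=.
    case=> H1 H2; split; last by apply: H2; rewrite ltnSn addnS ltnS leq_addr.
    split; first by split=> // j /andP[ij]; rewrite addn0 leqNgt ij.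
    by move=> j /= /andP[ij jl]; apply: H2; rewrite (ltn_trans _ ij) //= addnS -addSn.
  case=> -[[H1 _] H2] H3; split=> // j /andP[]; rewrite leq_eqVlt => /predU1P[<- //|ij] jl.
  by apply: H2 => /=; rewrite ij addSn -addnS.
rewrite (@measure_finite_partition _ _ _ _ _ _ _ E (mem (A i.+1))) //; last first.
  by move=> y; apply: Xm; apply: tp; rewrite addnS ltnS leq_addr.
rewrite [cylinder_weight _ _ _]/= big_distrr /= -sumEFin; apply: eq_bigr => y yA.
have -> : E `&` [set w | X (t i.+1) w = y] = cyl i.+1 l (x' y).
  apply/seteqP; split=> w /=.
    case=> -[[H1 _] H2] H3; split=> [j|j jl]; last exact: H2.
    rewrite leq_eqVlt => /predU1P[->|ji]; first by rewrite x'S.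
    by rewrite x'E //; apply: H1.
  case=> H1 H2; split; last by rewrite H1 // x'S.
  split=> //; split=> [j ji|j /andP[ij]]; last by rewrite addn0 leqNgt ij.
  by rewrite H1 1?ltnW // x'E.
rewrite IH; last by move=> j; rewrite addSn -addnS; apply: ti.
rewrite big_ord_recr /= !x'S !x'E // !mulrA; congr (_ * _ * _ * _)%:E.
by apply: eq_bigr => j _; rewrite !x'E // ltnW.
Qed.

Lemma cylinder_prob n : (forall i, (i < n)%N -> t i <= t i.+1) ->
  P [set w | forall j, (j <= n)%N -> X (t j) w \in A j] =
  (\sum_(x in A 0%N) nu x * cylinder_weight 0 n x)%:E.
Proof.
move=> tn; have tp := t_ge0 tn.
pose E := \bigcap_(j in [set j | (0 < j <= n)%N]) [set w | X (t j) w \in A j].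
have mE : measurable E.
  apply: fin_bigcap_measurable => // j /= /andP[_ lj].
  by apply: measurable_finite_mem => y; apply: Xm; apply: tp.
have -> : [set w | forall j, (j <= n)%N -> X (t j) w \in A j] =
    E `&` [set w | X (t 0%N) w \in A 0%N].
  apply/seteqP; split=> w /=; first by move=> H; split=> [j /= /andP[_]|]; apply: H.
  by case=> H1 H2 [|j] jn //; apply: H1.
rewrite (@measure_finite_partition _ _ _ _ _ _ _ E (mem (A 0%N))) //; last first.
  by move=> y; apply: Xm; apply: tp.
rewrite -sumEFin; apply: eq_bigr => y yA.
have -> : E `&` [set w | X (t 0%N) w = y] = cyl 0 n (fun=> y).
  apply/seteqP; split=> w /=.
    by case=> H1 H2; split=> [j|//]; rewrite leqn0 => /eqP ->.
  by case=> H1 H2; split=> //; apply: H1.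
by rewrite cyl_prob // big_ord0 mulr1.
Qed.

End CylinderEvents.

(** * Properties of the transition probabilities *)

Section TransitionKernel.
Variables (R : realType) (S : finType) (d : measure_display)
  (Omega : measurableType d) (P : probability Omega R)
  (Q : S -> S -> R) (X : (S -> R) -> R -> Omega -> S).
Hypothesis X_ctmc : forall nu, is_law nu -> is_ctmc P Q nu (X nu).

Lemma point_law_is_law (x : S) : is_law (point_law R x).
Proof.
split=> [y|]; first exact: ler0n.
rewrite (bigD1 x) //= /point_law eqxx big1 ?addr0 // => y /negbTE.
by rewrite eq_sym => ->.
Qed.

Lemma sum_point_law (x : S) (f : S -> R) : \sum_y point_law R x y * f y = f x.
Proof.
rewrite (bigD1 x) //= /point_law eqxx mul1r big1 ?addr0 // => y.
by rewrite eq_sym => /negbTE ->; rewrite mul0r.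
Qed.

Lemma state_prob (nu : S -> R) (t : R) (y : S) : is_law nu -> 0 <= t ->
  P [set w | X nu t w = y] = (\sum_x nu x * transition Q t x y)%:E.
Proof.
move=> nu_law t0; pose T := nth 0 [:: 0; t].
pose A := nth [set: S]%SET [:: [set: S]%SET; [set y]%SET].
have -> : [set w | X nu t w = y] =
    [set w | forall j, (j <= 1)%N -> X nu (T j) w \in A j].
  apply/seteqP; split=> w /=.
    by move=> E [|[|j]] // _; rewrite ?finset.in_setT //= E finset.in_set1.
  by move=> /(_ 1%N isT); rewrite finset.in_set1 => /eqP.
rewrite (cylinder_prob (X_ctmc nu_law)) //; last by case.
rewrite /= (eq_bigl predT) => [|x]; last by rewrite finset.in_setT.
by under eq_bigr do rewrite big_set1 mulr1 subr0.
Qed.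

(** Positivity, unit mass and the semigroup law are read off from the chain through this identity,
    with no manipulation of the exponential series. *)
Lemma transition_prob (t : R) (x y : S) : 0 <= t ->
  P [set w | X (point_law R x) t w = y] = (transition Q t x y)%:E.
Proof. by move=> t0; rewrite state_prob ?sum_point_law //; exact: point_law_is_law. Qed.

Lemma transition_ge0 (t : R) (x y : S) : 0 <= t -> 0 <= transition Q t x y.
Proof. by move=> t0; rewrite -lee_fin -transition_prob. Qed.

Lemma transition_sum1 (t : R) (x : S) : 0 <= t -> \sum_y transition Q t x y = 1.
Proof.
move=> t0; apply: EFin_inj; rewrite -sumEFin -(probability_setT P).
have Zm y : measurable [set w | X (point_law R x) t w = y].
  exact: ctmc_measurable (X_ctmc (point_law_is_law x)) _ _ t0.
have := @measure_finite_partition _ _ _ _ P _ Zm setT predT measurableT.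
rewrite (_ : [set w | predT _] = setT); last by apply/seteqP; split.
by rewrite setTI => ->; apply: eq_bigr => y _; rewrite setTI transition_prob.
Qed.

Lemma transition0 (x y : S) : transition Q 0 x y = (x == y)%:R.
Proof.
apply: EFin_inj; rewrite -transition_prob //.
have := @ctmc_fdd _ _ _ _ _ _ _ _ (X_ctmc (point_law_is_law x)) 0 (fun=> 0) (fun=> y) erefl.
rewrite big_ord0 mulr1 /point_law eq_sym => <- //; congr (P _).
by apply/seteqP; split=> w /=; [move=> H [|j]|move=> /(_ 0%N isT)].
Qed.

Lemma transitionD (s t : R) (x z : S) : 0 <= s -> 0 <= t ->
  transition Q (s + t) x z = \sum_y transition Q s x y * transition Q t y z.
Proof.
move=> s0 t0; apply: EFin_inj; rewrite -transition_prob ?addr_ge0 //.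
(* A three-time cylinder whose middle state is left free. *)
pose T := nth 0 [:: 0; s; s + t].
pose A := nth [set: S]%SET [:: [set: S]%SET; [set: S]%SET; [set z]%SET].
have -> : [set w | X (point_law R x) (s + t) w = z] =
    [set w | forall j, (j <= 2)%N -> X (point_law R x) (T j) w \in A j].
  apply/seteqP; split=> w /=.
    by move=> E [|[|[|j]]] // _; rewrite ?finset.in_setT //= E finset.in_set1.
  by move=> /(_ 2%N isT); rewrite finset.in_set1 => /eqP.
rewrite (cylinder_prob (X_ctmc (point_law_is_law x))) //; last first.
  by case=> [|[|]] //= _; rewrite lerDl.
rewrite /= (eq_bigl predT) => [|y]; last by rewrite finset.in_setT.
rewrite sum_point_law (eq_bigl predT) => [|y]; last by rewrite finset.in_setT.
congr (_%:E); apply: eq_bigr => y _.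
by rewrite big_set1 mulr1 subr0 addrAC subrr add0r.
Qed.

Lemma iter_kill_transition (delta : R) (n : nat) (f : S -> R) (x : S) : 0 <= delta ->
  iter n (kill (transition Q delta) finset.set0) f x =
  \sum_y transition Q (n%:R * delta) x y * f y.
Proof.
move=> d0; elim: n x => [|n IH] x /=.
  rewrite mul0r (bigD1 x) //= transition0 eqxx mul1r big1 ?addr0 // => y.
  by rewrite eq_sym transition0 => /negbTE ->; rewrite mul0r.
rewrite (eq_kill _ _ _ IH) /kill finset.in_set0 -natr1 mulrDl mul1r addrC.
under [RHS]eq_bigr do rewrite transitionD ?mulr_ge0 // mulr_suml.
rewrite exchange_big /=; apply: eq_bigr => y _; rewrite mulr_sumr.
by apply: eq_bigr => z _; rewrite mulrA.
Qed.

Lemma avoid_prob (nu : S -> R) (K : {set S}) (delta : R) (n : nat) :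
  is_law nu -> 0 <= delta ->
  P [set w | forall j, (j <= n)%N -> X nu (j%:R * delta) w \notin K] =
  (\sum_x nu x * avoid (transition Q delta) K n x)%:E.
Proof.
move=> nu_law d0.
have -> : [set w | forall j, (j <= n)%N -> X nu (j%:R * delta) w \notin K] =
    [set w | forall j, (j <= n)%N -> X nu (j%:R * delta) w \in (~: K)%SET].
  by apply/seteqP; split=> w /= H j /H; rewrite finset.in_setC.
rewrite (cylinder_prob (X_ctmc nu_law) (t := fun j => j%:R * delta) (fun=> (~: K)%SET)) ?mul0r //.
  congr (_%:E); rewrite big_mkcond /=; apply: eq_bigr => x _.
  rewrite finset.in_setC; case: ifPn => xK; last first.
    by rewrite avoid_in ?mulr0 // -(negbK (_ \in _)).
  congr (_ * _); elim: n {nu_law} 0%N x xK => [|n IH] i x xK.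
    by rewrite /avoid /= xK.
  rewrite avoidS /kill (negbTE xK) [LHS]big_mkcond; apply: eq_bigr => y _.
  rewrite finset.in_setC; case: ifPn => yK; last first.
    by rewrite avoid_in ?mulr0 // -(negbK (_ \in _)).
  by rewrite -(IH i.+1) // -mulrBl -natrB // subSnn mul1r.
by move=> i _; rewrite ler_wpM2r // ler_nat.
Qed.

End TransitionKernel.

(** * Hitting times as limits of dyadic sampling *)

Section HittingTimes.
Variables (R : realType) (S : finType) (d : measure_display)
  (Omega : measurableType d) (P : probability Omega R)
  (Q : S -> S -> R) (nu : S -> R) (X : R -> Omega -> S).
Hypothesis X_ctmc : is_ctmc P Q nu X.
Implicit Types (K : {set S}) (t rho : R).

Lemma hitting_time_ge0 K w : (0 <= hitting_time X K w)%E.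
Proof. by apply/ereal_infP => _ [t [t0 _] <-]; rewrite lee_fin. Qed.

(** The closed interval matches the strict inequality by right continuity: a path outside [K] at
    time [t] keeps its state for a while, so the infimum exceeds [t]. *)
Lemma lt_hitting_time K t w : 0 <= t ->
  (t%:E < hitting_time X K w)%E <-> (forall s, 0 <= s <= t -> X s w \notin K).
Proof.
move=> t0; split=> [lt s /andP[s0 st]|H].
  apply/negP => sK; move: lt; rewrite ltNge => /negP; apply.
  apply: le_trans (_ : (s%:E <= _)%E); last by rewrite lee_fin.
  by apply: ereal_inf_lbound; exists s.
have [e e0 he] := ctmc_right_continuous X_ctmc w t0.
apply: (@lt_le_trans _ _ (t + e)%:E); first by rewrite lte_fin ltrDl.
apply/ereal_infP => _ [s [s0 sK] <-]; rewrite lee_fin leNgt.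
apply/negP => ste; have [st|ts] := leP s t.
  by have := H s; rewrite s0 st sK => /(_ isT).
have := H t; rewrite t0 lexx => /(_ isT) /negP; apply.
by rewrite -(he s) // ste ltW.
Qed.

Definition grid_avoid K rho (k m : nat) : set Omega :=
  [set w | forall j, (j <= k * 2 ^ m)%N -> X (j%:R * (rho / (2 ^ m)%:R)) w \notin K].

(** If [K] is occupied at time [s], right continuity keeps the path there for a while, and a fine
    enough grid has a point in that interval. *)
Lemma bigcap_grid_avoid K rho k : 0 < rho ->
  \bigcap_m grid_avoid K rho k m =
  [set w | ((k%:R * rho)%:E < hitting_time X K w)%E].
Proof.
move=> rho0; apply/seteqP; split=> w /=; last first.
  move=> /lt_hitting_time H m _ j jk; apply: H.
    by rewrite mulr_ge0 // ltW.
  rewrite mulr_ge0 ?divr_ge0 ?(ltW rho0) //= mulrA ler_pdivrMr ?ltr0n ?expn_gt0 //.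
  by rewrite mulrAC ler_wpM2r ?(ltW rho0) // -natrM ler_nat.
move=> H; apply/lt_hitting_time; first by rewrite mulr_ge0 // ltW.
move=> s /andP[s0]; rewrite le_eqVlt => /predU1P[->|sk].
  by have := H 0%N I k; rewrite expn0 muln1 divr1 => /(_ (leqnn _)).
have [e e0 he] := ctmc_right_continuous X_ctmc w s0.
(* The second bound keeps the grid point within the horizon [k * rho]; the final time itself lies on
   the coarsest grid. *)
pose e' := Num.min e (k%:R * rho - s).
have e'0 : 0 < e' by rewrite lt_min e0 subr_gt0.
(* Then [rho / e' < m + 1 <= 2 ^ m]. *)
pose m := Num.truncn (rho / e').
have m_lt : rho / (2 ^ m)%:R < e'.
  rewrite ltr_pdivrMr ?ltr0n ?expn_gt0 // mulrC -ltr_pdivrMr //.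
  have /andP[_] := truncn_itv (ltW (divr_gt0 rho0 e'0)).
  by move=> /lt_le_trans; apply; rewrite ler_nat ltn_expl.
have delta0 : 0 < rho / (2 ^ m)%:R by rewrite divr_gt0 // ltr0n expn_gt0.
set delta := rho / _ in m_lt delta0.
pose j := (Num.truncn (s / delta)).+1.
have /andP[jl ju] := truncn_itv (divr_ge0 s0 (ltW delta0)).
have sj : s < j%:R * delta by rewrite -ltr_pdivrMr.
have js : j%:R * delta <= s + delta.
  by rewrite -natr1 mulrDl mul1r lerD2r -ler_pdivlMr.
have jk : (j <= k * 2 ^ m)%N.
  rewrite -(ler_nat R) -(ler_pM2r delta0); apply: le_trans js _.
  have -> : (k * 2 ^ m)%:R * delta = k%:R * rho.
    by rewrite /delta natrM; field; rewrite pnatr_eq0 expn_eq0.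
  rewrite -lerBrDl; apply: le_trans (ltW m_lt) _.
  by rewrite ge_min lexx orbT.
rewrite -(he (j%:R * delta)); first exact: H.
rewrite (ltW sj) /=; apply: le_lt_trans js _; rewrite ltrD2l.
by apply: lt_le_trans m_lt _; rewrite ge_min lexx.
Qed.

Lemma measurable_grid_avoid K rho k m : 0 <= rho -> measurable (grid_avoid K rho k m).
Proof.
move=> rho0.
have -> : grid_avoid K rho k m = \bigcap_(j in `I_(k * 2 ^ m).+1)
    [set w | X (j%:R * (rho / (2 ^ m)%:R)) w \notin K].
  by apply/seteqP; split=> w.
apply: fin_bigcap_measurable => // j _.
apply: (@measurable_finite_mem _ _ _ _ _ [pred x | x \notin K]) => x.
by apply: (ctmc_measurable X_ctmc); rewrite mulr_ge0 // divr_ge0.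
Qed.

Lemma measurable_lt_hitting_time K t : measurable [set w | (t%:E < hitting_time X K w)%E].
Proof.
have [t_lt0|] := ltP t 0.
  rewrite (_ : [set w | _] = setT) //; apply/seteqP; split=> // w _ /=.
  by apply: lt_le_trans (hitting_time_ge0 _ _); rewrite lte_fin.
rewrite le_eqVlt => /predU1P[<-|t_gt0].
  have := @bigcap_grid_avoid K 1 0 ltr01; rewrite mul0r => <-.
  by apply: bigcapT_measurable => m; apply: measurable_grid_avoid.
have := @bigcap_grid_avoid K t 1 t_gt0; rewrite mul1r => <-.
by apply: bigcapT_measurable => m; apply: measurable_grid_avoid; apply: ltW.
Qed.

Lemma measurable_hitting_time K : measurable_fun setT (hitting_time X K).
Proof.
apply: (measurability _ (ErealGenOInfty.measurableE R)) => // _ [_ [x ->] <-].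
rewrite setTI (_ : _ @^-1` _ = [set w | (x%:E < hitting_time X K w)%E]).
  exact: measurable_lt_hitting_time.
by apply/seteqP; split=> w /=; rewrite in_itv /= andbT.
Qed.

(** Dyadic grids are nested, so the events decrease and continuity from above applies. *)
Lemma grid_avoid_cvg K rho k : 0 < rho ->
  (fun m => fine (P (grid_avoid K rho k m))) @ \oo --> hit_after P X K (k%:R * rho).
Proof.
move=> rho0; apply: fine_cvg; rewrite /hit_after -bigcap_grid_avoid //.
rewrite fineK ?fin_num_measure //; last first.
  by apply: bigcapT_measurable => m; apply: measurable_grid_avoid; apply: ltW.
apply: nonincreasing_cvg_mu.
- by rewrite -ge0_fin_numE // fin_num_measure //; apply: measurable_grid_avoid; apply: ltW.
- by move=> m; apply: measurable_grid_avoid; apply: ltW.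
- by apply: bigcapT_measurable => m; apply: measurable_grid_avoid; apply: ltW.
- apply/nonincreasing_seqP => m; apply/subsetPset => w H j jk.
  have := H (2 * j)%N; rewrite expnS mulnCA leq_pmul2l // => /(_ jk).
  rewrite natrM natrM; congr (X _ w \notin K); field.
  by rewrite pnatr_eq0 expn_eq0.
Qed.

Lemma hit_by_after K t : hit_by P X K t = 1 - hit_after P X K t.
Proof.
rewrite /hit_by /hit_after (_ : [set w | (_ <= _)%E] = ~` [set w | (t%:E < hitting_time X K w)%E]).
  by rewrite probability_setC ?fineB ?fin_num_measure //; apply: measurable_lt_hitting_time.
by apply/seteqP; split=> w /=; rewrite leNgt => /negP.
Qed.

End HittingTimes.

(** * Irreducibility *)

Section TransitionPositive.
Variables (R : realType) (S : finType) (d : measure_display)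
  (Omega : measurableType d) (P : probability Omega R)
  (Q : S -> S -> R) (X : (S -> R) -> R -> Omega -> S).
Hypothesis X_ctmc : forall nu, is_law nu -> is_ctmc P Q nu (X nu).

(** Bounds the generator in sup norm; the 2 comes from the difference [g y - g x]. *)
Let M : R := 2 * \sum_x \sum_y `|Q x y|.

Let M_ge0 : 0 <= M.
Proof. by rewrite mulr_ge0 // sumr_ge0 // => x _; rewrite sumr_ge0. Qed.

Lemma iter_generator_bound (k : nat) (g : S -> R) : (forall x, `|g x| <= 1) ->
  forall x, `|iter k (generator Q) g x| <= M ^+ k.
Proof.
move=> g1; elim: k => [|k IH] x; first by rewrite expr0.
rewrite iterS /generator; apply: le_trans (ler_norm_sum _ _ _) _.
apply: (@le_trans _ _ (\sum_y `|Q x y| * (2 * M ^+ k))).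
  rewrite [leRHS](bigID (fun y => y != x)) /= -[leLHS]addr0; apply: lerD.
    apply: ler_sum => y _; rewrite normrM ler_wpM2l //.
    by apply: le_trans (ler_normB _ _) _; rewrite mulr_natl mulr2n lerD.
  by apply: sumr_ge0 => y _; rewrite !mulr_ge0 ?exprn_ge0.
rewrite -mulr_suml mulrA exprS ler_wpM2r ?exprn_ge0 // mulrC ler_wpM2l //.
by rewrite [leRHS](bigD1 x) //= lerDl sumr_ge0 // => z _; apply: sumr_ge0.
Qed.

(** In the exponential series the term of order 0 vanishes, the next is [t * Q x y], and the rest is
    of order [t ^+ 2]. *)
Lemma transition_edge_gt0 (x y : S) : x != y -> 0 < Q x y ->
  exists2 t : R, 0 <= t & 0 < transition Q t x y.
Proof.
move=> xy q0; pose c k := iter k (generator Q) (fun z => (z == y)%:R) x.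
have cM k : `|c k| <= M ^+ k.
  by apply: iter_generator_bound => z; rewrite normr_nat lern1 leq_b1.
have c0 : c 0%N = 0 by rewrite /c /= (negbTE xy).
have c1 : c 1%N = Q x y.
  rewrite /c /= /generator (bigD1 y) /=; last by rewrite eq_sym.
  rewrite eqxx (negbTE xy) subr0 mulr1.
  by rewrite big1 ?addr0 // => z /andP[_ /negbTE ->]; rewrite subrr mulr0.
have M1 : 0 < M + 1 by apply: ltr_wpDl.
(* With [z = t * (M + 1)], the first bound gives [z <= 1/2], so the terms from order 2 on sum to at
   most [2 * z ^+ 2]; the second makes this at most half of [t * Q x y]. *)
pose t := Num.min (2^-1 / (M + 1)) (4^-1 * Q x y / (M + 1) ^+ 2).
have t0 : 0 < t by rewrite lt_min !divr_gt0 ?mulr_gt0 ?invr_gt0 ?exprn_gt0.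
have tM : t * (M + 1) <= 2^-1 by rewrite -ler_pdivlMr // ge_min lexx.
have tM2 : t * (M + 1) ^+ 2 <= 4^-1 * Q x y.
  by rewrite -ler_pdivlMr ?exprn_gt0 // ge_min lexx orbT.
exists t; first exact: ltW.
pose u k := t ^+ k / k`!%:R * c k.
have uM k : `|u k| <= (t * (M + 1)) ^+ k.
  rewrite normrM exprMn normrM ger0_norm ?exprn_ge0 ?(ltW t0) //.
  rewrite -mulrA ler_wpM2l ?exprn_ge0 ?(ltW t0) //.
  apply: le_trans (_ : M ^+ k <= _); last by rewrite lerXn2r ?nnegrE ?lerDl ?(ltW M1).
  rewrite -[leRHS]mul1r ler_pM // ger0_norm ?invr_ge0 //.
  by rewrite invf_le1 ?ltr0n ?fact_gt0 // ler1n fact_gt0.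
have tM0 : 0 <= t * (M + 1) by rewrite mulr_ge0 ?(ltW t0) ?(ltW M1).
have u_cvg : cvgn (series u).
  apply: normed_cvg; apply: (series_le_cvg (v_ := fun k => (t * (M + 1)) ^+ k)) => //.
  - by move=> k /=; apply: normr_ge0.
  - by move=> k; apply: exprn_ge0.
  rewrite (_ : GRing.exp _ = geometric 1 (t * (M + 1))); last first.
    by apply/funext => k; rewrite /geometric /= mul1r.
  apply: is_cvg_geometric_series; rewrite ger0_norm //.
  by apply: le_lt_trans tM _; lra.
have low n : t * Q x y - 2 * (t * (M + 1)) ^+ 2 <= series u n.+2.
  set z := t * (M + 1) in uM tM tM0 *.
  have geo m : \sum_(0 <= k < m) z ^+ k <= 2 - 2 * z ^+ m.
    elim: m => [|m IH]; first by rewrite big_geq // expr0 mulr1 subrr.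
    rewrite big_nat_recr //= exprS; have : z * z ^+ m <= 2^-1 * z ^+ m.
      by rewrite ler_wpM2r ?exprn_ge0.
    lra.
  have tail : - \sum_(0 <= k < n) u k.+2 <= 2 * z ^+ 2.
    rewrite -sumrN; apply: (@le_trans _ _ (\sum_(0 <= k < n) z ^+ 2 * z ^+ k)).
      apply: ler_sum => k _; rewrite -exprD; apply: le_trans (uM k.+2).
      by rewrite -normrN ler_norm.
    rewrite -mulr_sumr mulrC ler_wpM2r ?exprn_ge0 //; apply: le_trans (geo n) _.
    by rewrite lerBlDr lerDl mulr_ge0 ?exprn_ge0.
  rewrite /series /= 2?big_nat_recl //.
  have -> : u 0%N = 0 by rewrite /u c0 mulr0.
  have -> : u 1%N = t * Q x y by rewrite /u c1 expr1 divr1.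
  rewrite add0r; lra.
apply: lt_le_trans (_ : t * Q x y - 2 * (t * (M + 1)) ^+ 2 <= _).
  rewrite exprMn [t ^+ 2]expr2 -mulrA mulrCA -mulrBr mulr_gt0 //.
  by rewrite subr_gt0; lra.
rewrite /transition; apply: limr_ge => //; exists 2%N => // -[|[|n]] //= _.
Qed.

Lemma transition_connect_gt0 (x y : S) :
  connect [rel u v | (u != v) && (0 < Q u v)] x y ->
  exists2 t : R, 0 <= t & 0 < transition Q t x y.
Proof.
move=> /connectP[p]; elim: p x => [|z p IH] x /=.
  by move=> _ ->; exists 0 => //; rewrite (transition0 X_ctmc) eqxx.
move=> /andP[/andP[xz q0]] /IH{}IH /IH[t t0 pt].
have [s s0 ps] := transition_edge_gt0 xz q0.
exists (s + t); first exact: addr_ge0.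
rewrite (transitionD X_ctmc) //; apply: lt_le_trans (mulr_gt0 ps pt) _.
rewrite (bigD1 z) //= lerDl sumr_ge0 // => w _.
by rewrite mulr_ge0 // (transition_ge0 X_ctmc).
Qed.

End TransitionPositive.

(** * The limit of vanishing mesh *)

Lemma is_law_inhabited (R : realType) (S : finType) (nu : S -> R) :
  is_law nu -> inhabited S.
Proof.
case=> _; case: (pickP (fun _ : S => true)) => [x _ _|S0]; first by exists.
by rewrite big_pred0 // => /esym/eqP; rewrite oner_eq0.
Qed.

(** As the masses agree, [f] may be recentred at 1/2; then its absolute value is at most 1/2, which
    is the factor in [dTV]. *)
Lemma dTV_ge (R : realType) (S : finType) (p q f : S -> R) :
  \sum_x p x = \sum_x q x -> (forall x, 0 <= f x <= 1) ->
  \sum_x p x * f x <= \sum_x q x * f x + dTV p q.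
Proof.
move=> pq f01; rewrite -lerBlDl -sumrB /dTV mulr_sumr.
have -> : \sum_x (p x * f x - q x * f x) = \sum_x (p x - q x) * (f x - 2^-1).
  have z : \sum_x (p x - q x) = 0 by rewrite sumrB pq subrr.
  apply/eqP; rewrite -subr_eq0 -sumrB.
  rewrite (eq_bigr (fun x => (p x - q x) * 2^-1)) => [|x _]; last by lra.
  by rewrite -mulr_suml z mul0r.
apply: ler_sum => x _; apply: le_trans (ler_norm _) _.
rewrite normrM mulrC ler_wpM2r //.
by have := f01 x; rewrite ler_norml; lra.
Qed.

Section ContinuousLimit.
Variables (R : realType) (S : finType) (d : measure_display)
  (Omega : measurableType d) (P : probability Omega R)
  (Q : S -> S -> R) (X : (S -> R) -> R -> Omega -> S).
Hypothesis X_ctmc : forall nu, is_law nu -> is_ctmc P Q nu (X nu).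
Variable rho : R.
Hypothesis rho_gt0 : 0 < rho.

Let mesh (m : nat) := rho / (2 ^ m)%:R.

Let mesh_ge0 m : 0 <= mesh m. Proof. by rewrite divr_ge0 ?(ltW rho_gt0). Qed.

Let meshM m : (2 ^ m)%:R * mesh m = rho.
Proof. by rewrite /mesh mulrC divfK // pnatr_eq0 expn_eq0. Qed.

Lemma fine_grid_avoid (nu : S -> R) (K : {set S}) (k m : nat) : is_law nu ->
  fine (P (grid_avoid (X nu) K rho k m)) =
  \sum_x nu x * avoid (transition Q (mesh m)) K (k * 2 ^ m) x.
Proof. by move=> nu_law; rewrite /grid_avoid (avoid_prob X_ctmc) //; exact: mesh_ge0. Qed.

Lemma sum_avoid_cvg (nu : S -> R) (K : {set S}) (k : nat) : is_law nu ->
  (fun m => \sum_x nu x * avoid (transition Q (mesh m)) K (k * 2 ^ m) x) @ \oo -->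
  hit_after P (X nu) K (k%:R * rho).
Proof.
move=> nu_law.
have := @grid_avoid_cvg _ _ _ _ _ _ _ _ (X_ctmc nu_law) K _ k rho_gt0; apply: cvg_trans.
by apply: near_eq_cvg; apply: nearW => m /=; rewrite fine_grid_avoid.
Qed.

Arguments sum_avoid_cvg [nu] K k _ [_] _.

(** Sampling can only miss visits. Lower bounds on survival therefore pass to every mesh exactly. *)
Lemma hit_after_le_avoid (nu : S -> R) (K : {set S}) (k m : nat) : is_law nu ->
  hit_after P (X nu) K (k%:R * rho) <=
  \sum_x nu x * avoid (transition Q (mesh m)) K (k * 2 ^ m) x.
Proof.
move=> nu_law; rewrite -fine_grid_avoid // /hit_after.
rewrite -(bigcap_grid_avoid (X_ctmc nu_law)) //.
have mg n : measurable (grid_avoid (X nu) K rho k n).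
  by apply: (measurable_grid_avoid (X_ctmc nu_law)); apply: ltW.
apply: fine_le; rewrite ?fin_num_measure //; try exact: bigcapT_measurable.
by apply: le_measure; rewrite ?inE //; [exact: bigcapT_measurable|move=> w; exact].
Qed.

Arguments hit_after_le_avoid [nu] K k m _.

Let avoid_cvg (K : {set S}) (k : nat) (x : S) :
  (fun m => avoid (transition Q (mesh m)) K (k * 2 ^ m) x) @ \oo -->
  hit_after P (X (point_law R x)) K (k%:R * rho).
Proof.
have := sum_avoid_cvg K k (point_law_is_law R x); apply: cvg_trans.
by apply: near_eq_cvg; apply: nearW => m /=; rewrite sum_point_law.
Qed.

(** Upper bounds pass only to fine meshes, at the price of strictness; finiteness of the state space
    makes the mesh uniform in [x]. *)
Let avoid_near (K : {set S}) (k : nat) (c : R) :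
  (forall x, hit_after P (X (point_law R x)) K (k%:R * rho) < c) ->
  \forall m \near \oo, forall x, avoid (transition Q (mesh m)) K (k * 2 ^ m) x <= c.
Proof.
by move=> H; apply: filter_forall => x; apply: (cvgr_le _ (@avoid_cvg K k x)).
Qed.

Let a (nu : S -> R) (G : {set S}) (k : nat) := hit_after P (X nu) G (k%:R * rho).

Lemma hit_after_contraction (nu : S -> R) (G : {set S}) (k : nat) (q : R) :
  is_law nu -> (forall x, hit_after P (X (point_law R x)) G (k%:R * rho) < q) ->
  forall j, a nu G (j + k) <= q * a nu G j.
Proof.
move=> nu_law Hq j.
apply: (ler_cvg_to (sum_avoid_cvg G (j + k) nu_law)).
  by apply: cvgM; [exact: cvg_cst|exact: sum_avoid_cvg].
near=> m; rewrite /= mulr_sumr; apply: ler_sum => x _; rewrite mulrCA.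
have [nu0 _] := nu_law; rewrite ler_wpM2l // mulnDl.
apply: avoidD_le => [y z|]; first exact: (transition_ge0 X_ctmc).
by near: m; apply: avoid_near.
Unshelve. all: by end_near.
Qed.

Lemma hit_after_approx_mul (nu : S -> R) (B G : {set S}) (e dd r th : R) :
  is_law nu -> (forall x, x \in B -> x \notin G) ->
  0 <= e -> 0 <= th -> th <= 2^-1 -> r + e <= 4^-1 ->
  (forall x, x \in B -> hit_by P (X (point_law R x)) G (2 * rho) <= e) ->
  dbar P X B rho <= dd ->
  (forall x, hit_after P (X (point_law R x)) (B :|: G) rho < r) ->
  1 - th <= a nu G 1 ->
  forall j k, `|a nu G (j + k) - a nu G j * a nu G k| <= 5 * (e + dd + r + th) * a nu G j.
Proof.
move=> nu_law BG e0 th0 th2 re He Hd Hr Hth j k.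
have dd0 : 0 <= dd.
  by apply: le_trans Hd; apply: bigmax_ge_id.
have r0 : 0 <= r.
  have [x] := is_law_inhabited nu_law.
  by apply: le_trans (ltW (Hr x)); apply: fine_ge0.
have A i := sum_avoid_cvg G i nu_law.
apply: (ler_cvg_to (cvg_norm (cvgB (A (j + k)%N) (cvgM (A j) (A k))))).
  by apply: cvgM; [exact: cvg_cst|exact: A].
near=> m.
have p0 x y : 0 <= transition Q (mesh m) x y by exact: (transition_ge0 X_ctmc).
have p1 x : \sum_y transition Q (mesh m) x y = 1 by exact: (transition_sum1 X_ctmc).
apply: (@avoid_approx_mul _ _ _ p0 p1 B G (2 ^ m) nu e dd r th) => //.
- move=> x xB; have := hit_after_le_avoid G 2 m (point_law_is_law R x).
  rewrite sum_point_law; apply: le_trans.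
  by have := He x xB; rewrite (hit_by_after (X_ctmc (point_law_is_law R x))); lra.
- move=> x x' xB x'B f f01; rewrite !(iter_kill_transition X_ctmc) // meshM.
  apply: le_trans (dTV_ge (q := transition Q rho x') _ f01) _.
    by rewrite !(transition_sum1 X_ctmc) // ltW.
  rewrite lerD2l; apply: le_trans Hd; rewrite /dbar.
  have E y : transition Q rho y = marginal P X y rho.
    by apply/funext => z; rewrite /marginal (transition_prob X_ctmc) // ltW.
  rewrite !E.
  apply: le_trans (le_bigmax_cond _ _ xB).
  exact: (le_bigmax_cond _ (fun x'' => dTV (marginal P X x rho) (marginal P X x'' rho)) x'B).
- move=> x; rewrite -[(2 ^ m)%N]mul1n; move: x; near: m; apply: avoid_near.
  by move=> x; rewrite mul1r.
- by apply: le_trans Hth _; exact: hit_after_le_avoid.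
Unshelve. all: by end_near.
Qed.

(** Each state has a time at which it occupies [y] with positive probability; a horizon beyond all
    these times works for every state. *)
Lemma hit_after_lt1 (G : {set S}) : irreducible_rate Q -> G != finset.set0 ->
  exists k : nat, forall x, hit_after P (X (point_law R x)) G (k%:R * rho) < 1.
Proof.
move=> irr /set0Pn[y yG].
suff /filter_ex[k Hk] : \forall k \near \oo, forall x,
    hit_after P (X (point_law R x)) G (k%:R * rho) < 1 by exists k.
apply: filter_forall => x.
have [t t0 pt] := transition_connect_gt0 X_ctmc (irr x y).
near=> k.
have tk : t <= k%:R * rho.
  rewrite -ler_pdivrMr //; near: k; exact: nbhs_infty_ger.
have lx := point_law_is_law R x.
apply: (@le_lt_trans _ _ (1 - transition Q t x y)); last by lra.
have mY : measurable [set w | X (point_law R x) t w = y].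
  exact: (ctmc_measurable (X_ctmc lx)).
rewrite -lee_fin EFinB -(transition_prob X_ctmc) // -probability_setC //.
rewrite /hit_after fineK ?fin_num_measure //; last first.
  exact: (measurable_lt_hitting_time (X_ctmc lx)).
apply: le_measure; rewrite ?inE.
- exact: (measurable_lt_hitting_time (X_ctmc lx)).
- exact: measurableC.
move=> w /= Hw Xy; have T0 : 0 <= k%:R * rho by rewrite mulr_ge0 // ltW.
have [/(_ Hw) H _] := @lt_hitting_time _ _ _ _ _ _ _ _ (X_ctmc lx) G _ w T0.
by have := H t; rewrite t0 tk Xy yG => /(_ isT).
Unshelve. all: by end_near.
Qed.

End ContinuousLimit.

(** * Convergence to the exponential law *)

Section LayerCake.
Variables (R : realType) (d : measure_display) (Omega : measurableType d)
  (P : probability Omega R) (Y : Omega -> \bar R) (rho L : R).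
Hypothesis Y_meas : measurable_fun setT Y.
Hypothesis Y_ge0 : forall w, (0 <= Y w)%E.
Hypothesis rho_gt0 : 0 < rho.
Let a (k : nat) : R := fine (P [set w | ((k%:R * rho)%:E < Y w)%E]).
Hypothesis sum_a : series a @ \oo --> L.

Let mA k : measurable [set w | ((k%:R * rho)%:E < Y w)%E].
Proof. by rewrite -[X in measurable X]setTI; apply: emeasurable_fun_o_infty. Qed.

Let count (i n : nat) (w : Omega) : \bar R :=
  (\sum_(i <= k < n) (rho * \1_[set w | ((k%:R * rho)%:E < Y w)%E] w)%:E)%E.

Let term_meas k :
  measurable_fun setT (fun w => (rho * \1_[set w | ((k%:R * rho)%:E < Y w)%E] w)%:E).
Proof.
by apply/measurable_EFinP; apply: measurable_funM => //; apply: measurable_indic.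
Qed.

Let int_term k :
  (\int[P]_w (rho * \1_[set w | ((k%:R * rho)%:E < Y w)%E] w)%:E = (rho * a k)%:E)%E.
Proof.
under eq_integral do rewrite EFinM.
rewrite ge0_integralZl //=; last 2 first.
- by apply/measurable_EFinP; apply: measurable_indic.
- by rewrite lee_fin ltW.
by rewrite integral_indic // setIT [RHS]EFinM /a fineK ?fin_num_measure.
Qed.

Let countE i n w :
  count i n w = (rho * \sum_(i <= k < n) ((k%:R * rho)%:E < Y w)%E%:R)%:E.
Proof.
rewrite /count sumEFin mulr_sumr; congr (_%:E); apply: eq_bigr => k _.
by rewrite indicE mem_setE.
Qed.

(** Each [k >= 1] with [k * rho < Y] accounts for an interval of length [rho] below [Y]. The index 0
    need not, hence [L - a 0]. *)
Lemma expectation_ge : ((rho * (L - a 0))%:E <= \int[P]_w Y w)%E.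
Proof.
(* Truncation at [n * rho] supports the induction on [n] and covers infinite values of [Y]. *)
have low n w : (count 1 n.+1 w <= mine (Y w) (n%:R * rho)%:E)%E.
  rewrite countE; have := Y_ge0 w; case: (Y w) => [y||] // y0.
    rewrite -EFin_min lee_fin le_min; rewrite lee_fin in y0.
    suff : rho * \sum_(1 <= k < n.+1) (k%:R * rho < y)%R%:R <= Num.min y (n%:R * rho).
      by rewrite le_min.
    elim: n => [|n IH]; first by rewrite big_geq // mulr0 mul0r le_min y0 lexx.
    rewrite big_nat_recr //= mulrDr; move: IH; rewrite !le_min => /andP[I1 I2].
    case: ltP => ny; rewrite ?mulr1 ?mulr0 ?addr0; last first.
      by rewrite I1 /= (le_trans I2) // ler_wpM2r ?(ltW rho_gt0) // ler_nat.
    by move: ny; rewrite -natr1 mulrDl mul1r => ny; apply/andP; split; lra.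
  rewrite minye lee_fin mulrC ler_wpM2r ?(ltW rho_gt0) //.
  under eq_bigr do rewrite ltry.
  by rewrite sumr_const_nat subSS subn0.
have fin n : ((rho * (series a n.+1 - a 0))%:E <= \int[P]_w Y w)%E.
  apply: (@le_trans _ _ (\int[P]_w count 1 n.+1 w)%E); last first.
    apply: ge0_le_integral => //.
    - by move=> w _; apply: sume_ge0 => k _; rewrite lee_fin mulr_ge0 // ltW.
    - exact: emeasurable_sum.
    - by move=> w _; apply: le_trans (low n w) _; rewrite ge_min lexx.
  rewrite /count ge0_integral_sum //; last first.
    by move=> k w _; rewrite lee_fin mulr_ge0 // ltW.
  under eq_bigr do rewrite int_term.
  rewrite sumEFin lee_fin -mulr_sumr ler_wpM2l ?(ltW rho_gt0) //.
  by rewrite /series /= big_nat_recl // addrAC subrr add0r big_add1.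
have lim : (fun n => rho * (series a n.+1 - a 0)) @ \oo --> rho * (L - a 0).
  apply: cvgM; first exact: cvg_cst.
  by apply: cvgB; [rewrite (cvg_shiftS (series a))|exact: cvg_cst].
have I0 : (0 <= \int[P]_w Y w)%E by apply: integral_ge0.
move: fin I0; case: (\int[P]_w Y w)%E => [m||] // fin _; last by rewrite leey.
rewrite lee_fin; apply: (ler_cvg_to lim (cvg_cst m)); near=> n.
by rewrite -lee_fin.
Unshelve. all: by end_near.
Qed.

(** The intervals of length [rho] starting at the points [k * rho < Y], with [k = 0] included, cover
    the interval from 0 to [Y]. *)
Lemma expectation_le : (\int[P]_w Y w <= (rho * L)%:E)%E.
Proof.
have term_ge0 k w : (0%R <= (rho * \1_[set w | ((k%:R * rho)%:E < Y w)%E] w)%:E)%E.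
  by rewrite lee_fin mulr_ge0 // ltW.
have up w : (Y w <= \sum_(0 <= k <oo)
    (rho * \1_[set w | ((k%:R * rho)%:E < Y w)%E] w)%:E)%E.
  have H n : (mine (Y w) (n%:R * rho)%:E <= \sum_(0 <= k <oo)
      (rho * \1_[set w | ((k%:R * rho)%:E < Y w)%E] w)%:E)%E.
    apply: le_trans (nneseries_lim_ge n _); last by move=> *; exact: term_ge0.
    rewrite -[leRHS]/(count 0 n w) countE; have := Y_ge0 w; case: (Y w) => [y||] // y0.
      rewrite -EFin_min lee_fin; rewrite lee_fin in y0.
      elim: n => [|n IH]; first by rewrite big_geq // mulr0 mul0r ge_min lexx orbT.
      rewrite big_nat_recr //= mulrDr.
      case: ltP => ny; rewrite ?mulr1 ?mulr0 ?addr0.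
        by move: IH; rewrite !ge_min -natr1 mulrDl mul1r => /orP[] H; apply/orP;
          [left|right]; move: rho_gt0; lra.
      by rewrite lee_fin in ny; apply: le_trans IH; rewrite le_min !ge_min lexx ny.
    rewrite minye lee_fin mulrC ler_wpM2l ?(ltW rho_gt0) //.
    under eq_bigr do rewrite ltry.
    by rewrite sumr_const_nat subn0.
  have : (0 <= \sum_(0 <= k <oo)
      (rho * \1_[set w | ((k%:R * rho)%:E < Y w)%E] w)%:E)%E by apply: nneseries_ge0.
  move: H; case: (\sum_(0 <= k <oo) _)%E => [s||] // H s0; last by rewrite leey.
  have := H (Num.truncn (s / rho)).+1; rewrite ge_min => /orP[//|].
  rewrite lee_fin leNgt -ltr_pdivrMr //.
  by have /andP[_ ->] := truncn_itv (divr_ge0 s0 (ltW rho_gt0)).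
apply: (@le_trans _ _ (\int[P]_w \sum_(0 <= k <oo)
    (rho * \1_[set w | ((k%:R * rho)%:E < Y w)%E] w)%:E)%E).
  by apply: ge0_le_integral => //; apply: ge0_emeasurable_sum.
rewrite integral_nneseries //; under eq_eseriesr do rewrite int_term.
rewrite le_eqVlt; apply/orP; left; apply/eqP; apply: cvg_lim => //.
rewrite (_ : (fun n => _) = EFin \o (fun n => rho * series a n)); last first.
  by apply/funext => n /=; rewrite sumEFin mulr_sumr.
by apply: cvg_EFin; [exact: nearW|apply: cvgM; [exact: cvg_cst|]].
Qed.

End LayerCake.

Lemma exponential_prob_itvNyc (R : realType) (t : R) :
  exponential_prob 1 `]-oo, t] = (if 0 <= t then 1 - expR (- t) else 0)%:E.
Proof.
have -> : exponential_prob 1 `]-oo, t] = exponential_prob 1 `[0, t].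
  rewrite /exponential_prob integral_mkcond [RHS]integral_mkcond.
  apply: eq_integral => x _; rewrite !patchE !mem_setE !in_itv /=.
  by have [x0|x0] := leP 0 x; rewrite //= lt0_exponential_pdf // if_same.
have [t0|t0] := leP 0 t; last first.
  by rewrite set_itv_ge ?bnd_simp -?ltNge // /exponential_prob integral_set0.
move: t0; rewrite le_eqVlt => /predU1P[<-|t0].
  by rewrite set_itv1 /exponential_prob integral_set1 oppr0 expR0 subrr.
by rewrite exponential_prob_itv0c // mulN1r EFinB.
Qed.

Section HitAfter.
Variables (R : realType) (S : finType) (d : measure_display)
  (Omega : measurableType d) (P : probability Omega R)
  (Q : S -> S -> R) (X : (S -> R) -> R -> Omega -> S).
Hypothesis X_ctmc : forall nu, is_law nu -> is_ctmc P Q nu (X nu).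
Implicit Types (nu : S -> R) (K : {set S}).

Lemma hit_after_ge0_le1 nu K (t : R) : is_law nu ->
  0 <= hit_after P (X nu) K t <= 1.
Proof.
move=> nu_law; rewrite fine_ge0 //= -lee_fin fineK ?probability_le1 //.
  exact: (measurable_lt_hitting_time (X_ctmc nu_law)).
by rewrite fin_num_measure //; exact: (measurable_lt_hitting_time (X_ctmc nu_law)).
Qed.

Lemma hit_after_le nu K (s t : R) : is_law nu -> s <= t ->
  hit_after P (X nu) K t <= hit_after P (X nu) K s.
Proof.
move=> nu_law st.
have m u : measurable [set w | (u%:E < hitting_time (X nu) K w)%E].
  exact: (measurable_lt_hitting_time (X_ctmc nu_law)).
apply: fine_le; rewrite ?fin_num_measure //.
apply: le_measure; rewrite ?inE //.
by move=> w /=; apply: le_lt_trans; rewrite lee_fin.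
Qed.

(** Chains with different initial laws are related only through their laws; averaging over the
    starting point is done for the sampled chain, where survival is linear in [nu]. *)
Lemma hit_after_ge_of_support nu (B K : {set S}) (rho c : R) (k : nat) : 0 < rho ->
  is_law nu -> (forall x, nu x != 0 -> x \in B) ->
  (forall x, x \in B -> c <= hit_after P (X (point_law R x)) K (k%:R * rho)) ->
  c <= hit_after P (X nu) K (k%:R * rho).
Proof.
move=> rho0 nu_law nuB HB.
have C := sum_avoid_cvg X_ctmc rho0 (K := K) (k := k) nu_law.
apply: (ler_cvg_to (f := fun=> c) _ C); first exact: cvg_cst.
apply: nearW => m; have [nu0 nu1] := nu_law.
have -> : c = \sum_x nu x * c by rewrite -mulr_suml nu1 mul1r.
apply: ler_sum => x _.
have [->|nux] := eqVneq (nu x) 0; first by rewrite !mul0r.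
rewrite ler_wpM2l //; apply: le_trans (HB x (nuB x nux)) _.
have := hit_after_le_avoid X_ctmc rho0 K k m (point_law_is_law R x).
by rewrite sum_point_law.
Qed.

Lemma cvg_series_hit_after nu (G : {set S}) (rho : R) : 0 < rho -> is_law nu ->
  irreducible_rate Q -> G != finset.set0 ->
  cvgn (series (fun k : nat => hit_after P (X nu) G (k%:R * rho))).
Proof.
move=> rho0 nu_law irr G0.
have [k Hk] := hit_after_lt1 X_ctmc rho0 irr G0.
pose q := \big[Num.max/0]_x hit_after P (X (point_law R x)) G (k%:R * rho).
have q1 : q < 1 by apply: bigmax_lt => //; exact: ltr01.
(* The midpoint of [q] and 1 restores the strict bound that survives sampling. *)
have Hq x : hit_after P (X (point_law R x)) G (k%:R * rho) < (1 + q) / 2.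
  by apply: (@le_lt_trans _ _ q); [apply: le_bigmax|lra].
apply: (@cvg_series_of_contraction _ _ k ((1 + q) / 2)).
- by move=> j; exact: hit_after_ge0_le1.
- by lra.
- by apply: (hit_after_contraction X_ctmc rho0 nu_law Hq).
Qed.

End HitAfter.

(** The common core of both claims: the initial law enters only through the chance [th n] of hitting
    [G n] within one unit. *)
Lemma normalized_hitting_time_cvg (R : realType) (S : nat -> finType)
  (Q : forall n, S n -> S n -> R)
  (irr : forall n, irreducible_rate (Q n))
  (d : nat -> measure_display)
  (Omega : forall n, measurableType (d n))
  (P : forall n, probability (Omega n) R)
  (X : forall n, (S n -> R) -> R -> Omega n -> S n)
  (X_ctmc : forall n (nu : S n -> R), is_law nu ->
    is_ctmc (P n) (Q n) nu (X n nu))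
  (B G : forall n, {set S n})
  (BG : forall n x, x \in B n -> x \notin G n)
  (G0 : forall n, G n != finset.set0)
  (rho e dd r th : nat -> R)
  (rho_gt0 : forall n, 0 < rho n)
  (e0 : forall n, 0 <= e n) (th0 : forall n, 0 <= th n)
  (He : forall n x, x \in B n -> hit_by (P n) (X n (point_law R x)) (G n) (2 * rho n) <= e n)
  (Hd : forall n, dbar (P n) (X n) (B n) (rho n) <= dd n)
  (Hr : forall n x, hit_after (P n) (X n (point_law R x)) (B n :|: G n) (rho n) < r n)
  (nu : forall n, S n -> R) (nu_law : forall n, is_law (nu n))
  (Hth : forall n, 1 - th n <= hit_after (P n) (X n (nu n)) (G n) (rho n))
  (e_cvg : e @ \oo --> (0 : R)) (d_cvg : dd @ \oo --> (0 : R))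
  (r_cvg : r @ \oo --> (0 : R)) (th_cvg : th @ \oo --> (0 : R)) :
  cvg_in_law P
    (fun n => normalized_hitting_time (P n) (X n (nu n)) (G n)) (exponential_prob 1).
Proof.
move=> t _; rewrite exponential_prob_itvNyc.
have dd0 n : 0 <= dd n by apply: le_trans (Hd n); apply: bigmax_ge_id.
have r0 n : 0 <= r n.
  have [x] := is_law_inhabited (nu_law n).
  by apply: le_trans (ltW (Hr n x)); apply: fine_ge0.
pose a n (k : nat) := hit_after (P n) (X n (nu n)) (G n) (k%:R * rho n).
pose kappa n := 5 * (e n + dd n + r n + th n).
have kappa0 : kappa @ \oo --> (0 : R).
  rewrite -(mulr0 5) -[X in 5 * X](addr0 0) -{1}(addr0 0) -{1}(addr0 0).
  by apply: cvgM; [exact: cvg_cst|do 3 apply: cvgD => //].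
have a01 n k : 0 <= a n k <= 1 by apply: hit_after_ge0_le1 (@X_ctmc n) _ _ _ _.
have sum_a n : series (a n) @ \oo --> limn (series (a n)).
  by apply: (cvg_series_hit_after (@X_ctmc n)).
pose L n := limn (series (a n)).
have aM : \forall n \near \oo, forall i j, `|a n (i + j)%N - a n i * a n j| <= kappa n * a n i.
  near=> n => i j.
  apply: (hit_after_approx_mul (@X_ctmc n) (rho_gt0 n) (nu_law n) (@BG n)) => //.
  - by near: n; apply: (cvgr_le _ th_cvg); rewrite invr_gt0.
  - by near: n; apply: (cvgr_le _ (cvgD r_cvg e_cvg)); rewrite addr0 invr_gt0.
  - exact: He.
  - by rewrite /a mul1r.
have a_near n : 1 - kappa n <= a n 1%N /\ 1 - kappa n <= a n 0%N.
  have H1 : 1 - kappa n <= a n 1%N.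
    rewrite /a mul1r; apply: le_trans (Hth n); rewrite /kappa.
    by have := e0 n; have := dd0 n; have := r0 n; have := th0 n; lra.
  split=> //; apply: le_trans H1 _; apply: (hit_after_le (@X_ctmc n)) => //.
  by rewrite ler_wpM2r ?(ltW (rho_gt0 n)).
pose tau n w := hitting_time (X n (nu n)) (G n) w.
have tau_meas n : measurable_fun setT (tau n).
  by apply: (measurable_hitting_time (X_ctmc n _ (nu_law n))).
have tau_ge0 n w : (0 <= tau n w)%E by exact: hitting_time_ge0.
pose m n := fine (\int[P n]_w tau n w)%E.
have m_fin n : (\int[P n]_w tau n w)%E = (m n)%:E.
  rewrite fineK // ge0_fin_numE; last exact: integral_ge0.
  exact: le_lt_trans (expectation_le (@tau_meas n) (@tau_ge0 n) (rho_gt0 n) (@sum_a n)) (ltry _).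
have m_le n : m n <= rho n * L n.
  by rewrite -lee_fin -m_fin;
    exact: (expectation_le (@tau_meas n) (@tau_ge0 n) (rho_gt0 n) (@sum_a n)).
have m_ge n : rho n * (L n - a n 0%N) <= m n.
  by rewrite -lee_fin -m_fin;
    exact: (expectation_ge (@tau_meas n) (@tau_ge0 n) (rho_gt0 n) (@sum_a n)).
(* [L n] is at least the sum of its first two terms, and [a n 1] is eventually positive. *)
have m_gt0 : \forall n \near \oo, 0 < m n.
  near=> n; apply: lt_le_trans (m_ge n); rewrite mulr_gt0 // subr_gt0.
  have L2 : series (a n) 2 <= L n.
    apply: nondecreasing_cvgn_le; last by apply/cvg_ex; exists (L n); exact: sum_a.
    by apply: nondecreasing_series => i _ _; case/andP: (a01 n i).
  apply: lt_le_trans L2; rewrite /series /= big_nat_recr //= big_nat1 ltrDl.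
  have [H _] := a_near n; apply: lt_le_trans H; rewrite subr_gt0; near: n.
  by apply: (cvgr_lt _ kappa0).
have E n : 0 < m n ->
    [set w | (normalized_hitting_time (P n) (X n (nu n)) (G n) w <= t%:E)%E] =
    [set w | (tau n w <= (t * m n)%:E)%E].
  move=> mn; apply/seteqP; split=> w /=; rewrite /normalized_hitting_time -/(tau n) m_fin;
    by rewrite inver gt_eqF // lee_pdivrMr // -EFinM.
have [t0|t0] := leP 0 t; last first.
  apply: cvg_near_cst; near=> n; rewrite E; last by near: n.
  rewrite (_ : [set w | _] = set0) ?measure0 //; apply/seteqP; split=> w //=.
  apply/negP; rewrite -ltNge; apply: lt_le_trans (tau_ge0 n w).
  by rewrite lte_fin nmulr_rlt0 //; near: n.
have ha : (fun n => hit_after (P n) (X n (nu n)) (G n) (t * m n)) @ \oo --> expR (- t).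
  pose k n := Num.truncn (t * m n / rho n).
  have kP n : 0 < m n -> (k n)%:R * rho n <= t * m n < (k n).+1%:R * rho n.
    move=> mn; rewrite -ler_pdivlMr // -ltr_pdivrMr //.
    by apply: truncn_itv; rewrite divr_ge0 ?mulr_ge0 ?(ltW mn) ?(ltW (rho_gt0 n)).
  (* The expectation lies between [rho n * (L n - 1)] and [rho n * L n], and rounding down loses
     less than one unit; this explains [t + 1]. Monotonicity then squeezes the tail between the two
     neighbouring multiples of [rho n]. *)
  have kL : \forall n \near \oo, `|(k n)%:R - t * L n| <= t + 1 /\
      `|(k n).+1%:R - t * L n| <= t + 1.
    near=> n; have /kP/andP[k1 k2] : 0 < m n by near: n.
    have H1 : (k n)%:R <= t * L n.
      rewrite -(ler_pM2r (rho_gt0 n)); apply: le_trans k1 _.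
      by rewrite -mulrA ler_wpM2l // mulrC.
    have H2 : t * (L n - 1) < (k n).+1%:R.
      rewrite -(ltr_pM2r (rho_gt0 n)); apply: le_lt_trans k2.
      rewrite -mulrA ler_wpM2l // mulrC; apply: le_trans (m_ge n).
      by rewrite ler_wpM2l ?(ltW (rho_gt0 n)) // lerD2l lerN2; case/andP: (a01 n 0%N).
    by move: H2; rewrite -natr1 !ler_norml; split; lra.
  apply: (@squeeze_cvgr _ _ _ _ (fun n => a n (k n).+1) (fun n => a n (k n))).
  - near=> n; have mn : 0 < m n by near: n.
    have /andP[k1 k2] := kP n mn.
    by rewrite !(hit_after_le (@X_ctmc n)) // ltW.
  - apply: (cvg_geometric_expR a01 aM _ kappa0 sum_a t0); first exact: nearW.
    by near=> n; have [] : `|(k n)%:R - t * L n| <= t + 1 /\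
      `|(k n).+1%:R - t * L n| <= t + 1 by near: n.
  - apply: (cvg_geometric_expR a01 aM _ kappa0 sum_a t0); first exact: nearW.
    by near=> n; have [] : `|(k n)%:R - t * L n| <= t + 1 /\
      `|(k n).+1%:R - t * L n| <= t + 1 by near: n.
have : (fun n => (1 - hit_after (P n) (X n (nu n)) (G n) (t * m n))%:E) @ \oo -->
    (1 - expR (- t))%:E.
  by apply: cvg_EFin; [exact: nearW|apply: cvgB => //; exact: cvg_cst].
apply: cvg_trans; apply: near_eq_cvg; near=> n.
have mn : 0 < m n by near: n.
rewrite E // -(hit_by_after (X_ctmc n _ (nu_law n))) /hit_by fineK //.
rewrite fin_num_measure // -[X in measurable X]setTI.
by apply: emeasurable_fun_infty_c => //; exact: tau_meas.
Unshelve. all: by end_near.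
Qed.

(** * Positivity of the invariant law and the two kinds of initial laws *)

Lemma invariant_law_gt0 (R : realType) (S : finType) (Q : S -> S -> R) (pi : S -> R) :
  is_rate Q -> irreducible_rate Q -> invariant_law Q pi -> forall y, 0 < pi y.
Proof.
move=> Q0 irr [[pi0 pi1] inv] y; rewrite lt_def pi0 andbT; apply/eqP => piy.
(* Balance at a state of zero mass forces its total inflow to vanish, so zeros propagate backwards
   along edges, and by irreducibility everywhere. *)
have back x z : x != z -> 0 < Q x z -> pi z = 0 -> pi x = 0.
  move=> xz qxz piz; have := inv z; rewrite piz mul0r => /eqP.
  rewrite psumr_eq0 => [/allP/(_ x)|w wz]; last by rewrite mulr_ge0 ?Q0.
  by rewrite mem_index_enum xz mulf_eq0 (gt_eqF qxz) orbF => /(_ isT)/eqP.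
have pi_eq0 x : pi x = 0.
  have /connectP[p] := irr x y; elim: p x => [|z p IH] x /=; first by move=> _ <-.
  by move=> /andP[/andP[xz qxz]] zp ly; apply: back xz qxz (IH z zp ly).
by move/eqP: pi1; rewrite big1 // eq_sym oner_eq0.
Qed.

Lemma cond_law_is_law (R : realType) (S : finType) (pi : S -> R) (A : {set S}) :
  (forall x, 0 <= pi x) -> 0 < \sum_(x in A) pi x -> is_law (cond_law pi A).
Proof.
move=> pi0 A0; split=> [x|]; rewrite /cond_law.
  by case: ifP => // _; rewrite divr_ge0 // ltW.
by rewrite -big_mkcond -mulr_suml divff // gt_eqF.
Qed.

Theorem corollary3p10 (R : realType) (alpha : R)
  (halpha : 0 < alpha < 1)
  (S : nat -> finType)
  (Q : forall n, S n -> S n -> R)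
  (hQ : forall n, is_rate (Q n))
  (hirr : forall n, irreducible_rate (Q n))
  (pi : forall n, S n -> R)
  (hpi : forall n, invariant_law (Q n) (pi n))
  (d : nat -> measure_display)
  (Omega : forall n, measurableType (d n))
  (P : forall n, probability (Omega n) R)
  (X Xrev : forall n, (S n -> R) -> R -> Omega n -> S n)
  (hX : forall n (nu : S n -> R), is_law nu ->
    is_ctmc (P n) (Q n) nu (X n nu))
  (hXrev : forall n (nu : S n -> R), is_law nu ->
    is_ctmc (P n) (reversed_rate (Q n) (pi n)) nu (Xrev n nu))
  (G : forall n, {set S n})
  (hG : forall n, G n != finset.set0)
  (hA : forall n, finset.setC (G n) != finset.set0)
  (rho delta f r : nat -> R)
  (hrho : forall n, 1 < rho n)
  (hdelta : forall n, 0 < delta n < 1)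
  (hf : forall n, 0 < f n < 1)
  (hr : forall n, 0 < r n < 1)
  (hHp : forall n, HpG (P n) (pi n) (X n) (Xrev n) (G n) alpha
    (rho n) (delta n) (f n) (r n))
  (hdelta0 : delta @ \oo --> (0 : R))
  (hf0 : f @ \oo --> (0 : R))
  (hr0 : r @ \oo --> (0 : R)) :
  cvg_in_law P
    (fun n => normalized_hitting_time (P n)
      (X n (cond_law (pi n) (finset.setC (G n)))) (G n))
    (exponential_prob 1)
  /\
  (forall mu : forall n, S n -> R,
    (forall n, is_law (mu n)) ->
    (forall n (x : S n), mu n x != 0 ->
      x \in Bset (P n) (X n) (Xrev n) (G n) alpha (rho n) (f n)) ->
    cvg_in_law P
      (fun n => normalized_hitting_time (P n) (X n (mu n)) (G n))
      (exponential_prob 1)).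
Proof.
case/andP: halpha => alpha_gt0 _.
have rho_gt0 n : 0 < rho n by apply: lt_trans (hrho n).
pose B n := Bset (P n) (X n) (Xrev n) (G n) alpha (rho n) (f n).
(* Membership in [B n] bounds the half sum of the forward and reversed hitting probabilities;
   dropping the nonnegative reversed one leaves the factor 2. *)
pose e n := 2 * f n `^ alpha.
have BG n x : x \in B n -> x \notin G n by rewrite !inE => /andP[].
have e0 n : 0 <= e n by rewrite mulr_ge0 // powR_ge0.
have He n x : x \in B n -> hit_by (P n) (X n (point_law R x)) (G n) (2 * rho n) <= e n.
  rewrite !inE => /andP[_]; rewrite /e.
  have : 0 <= hit_by (P n) (Xrev n (point_law R x)) (G n) (2 * rho n) by apply: fine_ge0.
  by lra.
have e_cvg : e @ \oo --> (0 : R).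
  rewrite -(mulr0 2); apply: cvgM; first exact: cvg_cst.
  have f_right : f @ \oo --> 0^'+.
    move=> V V0; have : \forall n \near \oo, 0 < f n -> V (f n) by exact: hf0 V0.
    by apply: filterS => n; apply; case/andP: (hf n).
  exact: cvg_comp f_right (powR_cvg0 alpha_gt0).
have Hd n : dbar (P n) (X n) (B n) (rho n) <= delta n by case: (hHp n).
have Hr n x : hit_after (P n) (X n (point_law R x)) (B n :|: G n)%SET (rho n) < r n.
  by case: (hHp n) => _ _; apply: le_lt_trans; apply: le_bigmax.
have escape n nu (c : R) : is_law nu -> 1 - c <= hit_after (P n) (X n nu) (G n) (2 * rho n) ->
    1 - c <= hit_after (P n) (X n nu) (G n) (rho n).
  move=> nu_law /le_trans; apply; apply: (hit_after_le (@hX n)) => //.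
  by rewrite mulr_natl mulr2n lerDl ltW.
split=> [|mu mu_law muB].
- have pi_law n : is_law (cond_law (pi n) (~: G n)%SET).
    have pi_gt0 := invariant_law_gt0 (@hQ n) (@hirr n) (@hpi n).
    have /set0Pn[y yA] := hA n.
    apply: cond_law_is_law => [x|]; first exact: ltW.
    by rewrite (bigD1 y) //= ltr_wpDr // sumr_ge0 // => x _; exact: ltW.
  (* Slow escape provides the starting error [th = f]. *)
  apply: (normalized_hitting_time_cvg hirr hX BG hG rho_gt0 e0 _ He Hd Hr
    pi_law _ e_cvg hdelta0 hr0 hf0).
    by move=> n; case/andP: (hf n) => /ltW.
  move=> n; apply: escape => //; have := HpG_E (hHp n).
  by rewrite /slow_escape /fA (hit_by_after (hX n _ (pi_law n))); lra.
(* For a law supported in [B n] the starting error is the escape error, [th = e]. *)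
- apply: (normalized_hitting_time_cvg hirr hX BG hG rho_gt0 e0 e0 He Hd Hr
    mu_law _ e_cvg hdelta0 hr0 e_cvg).
  move=> n; apply: escape => //.
  apply: (hit_after_ge_of_support (@hX n) (rho_gt0 n) (k := 2) (mu_law n) (muB n)) => x xB.
  have := He n x xB.
  by rewrite (hit_by_after (hX n _ (point_law_is_law R x))); lra.
Qed.
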